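(* For each positive integer $N$ let $G_{N^2}$ be an $N^2\times N^2$ Gaussian random matrix. Then the random matrices $G_{N^2}$, $G_{N^2}^{\Gamma_N}$ and $G_{N^2}^{M_N}$ form an asymptotically free family as $N\to\infty$, where $\Gamma_N$ is the $N\times N$ partial transpose and $M_N$ is the mixing map.
   Context: $[n]=\{1,\dots,n\}$ and $\mathcal{S}([n]^2)$ is the group of permutations of $[n]\times[n]$. For an $n\times n$ random matrix $A$ and $\sigma\in\mathcal{S}([n]^2)$, $A^\sigma$ is the $n\times n$ random matrix with $[A^\sigma]_{i,j}=[A]_{\sigma(i,j)}$. Let $\varphi:[N^2]^2\to[N]^4$ be the bijection given by $\varphi(i,j)=(a,b,c,d)$ whenever $(i,j)=((a-1)N+b,\ (c-1)N+d)$. Let $\gamma,\mu:[N]^4\to[N]^4$ be $\gamma(a,b,c,d)=(a,d,c,b)$ and $\mu(a,b,c,d)=(a,c,b,d)$. The $N\times N$ partial transpose is $\Gamma_N=\varphi^{-1}\circ\gamma\circ\varphi\in\mathcal{S}([N^2]^2)$ and the mixing map is $M_N=\varphi^{-1}\circ\mu\circ\varphi\in\mathcal{S}([N^2]^2)$. A random matrix $G_n=[g_{i,j}]_{1\le i,j\le n}$ is Gaussian if $g_{i,j}=\overline{g_{j,i}}$ for all $i,j$ and $\{g_{i,j}:1\le i\le j\le n\}$ is an independent family of mean-$0$ Gaussian random variables, complex for $i\ne j$ (with $E(g_{i,j}^2)=0$) and real for $i=j$, with $E(|g_{i,j}|^2)=1/n$. A finite family $\{A_{k,N}:1\le k\le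 M\}$, $N\in\mathbb{N}$, of random matrices (for each $N$ all square of the same size) is asymptotically free if there exist a non-commutative probability space $(\mathfrak{A},\phi)$ (a unital $*$-algebra over $\mathbb{C}$ with a positive unital linear functional) and a free family $\{a_1,\dots,a_M\}\subset\mathfrak{A}$ such that for every positive integer $R$ and all $(i_1,\dots,i_R)\in\{1,\dots,M\}^R$, $\lim_{N\to\infty}E\circ\mathrm{tr}(A_{i_1,N}\cdots A_{i_R,N})=\phi(a_{i_1}\cdots a_{i_R})$, where $\mathrm{tr}$ is the normalized trace and $E$ the expectation. *)

(* Defs.v *)
From HB Require Import structures.
From mathcomp Require Import all_boot all_order all_algebra fingroup perm.
From mathcomp Require Import all_classical all_reals all_analysis.
From mathcomp Require Import complex.
Set Implicit Arguments.
Unset Strict Implicit.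
Unset Printing Implicit Defensive.
Import Order.TTheory GRing.Theory Num.Theory.
Import numFieldNormedType.Exports.
Local Open Scope classical_set_scope.
Local Open Scope ring_scope.

Definition mx_perm (C : Type) (n : nat) (A : 'M[C]_n) (s : {perm 'I_n * 'I_n}) :
    'M[C]_n :=
  \matrix_(i, j) A (s (i, j)).1 (s (i, j)).2.

Section EntryPermutations.
Variable N : nat.

Local Notation idx2 := ('I_(N * N) * 'I_(N * N))%type.
Local Notation idx4 := ('I_N * 'I_N * 'I_N * 'I_N)%type.

Lemma pair_idx_subproof (a b : 'I_N) : (a * N + b < N * N)%N.
Proof.
apply: (@leq_trans (a.+1 * N)); last by rewrite leq_mul2r ltn_ord orbT.
by rewrite mulSn addnC ltn_add2r.
Qed.

(* Indices are counted from 0, so that the 1-based (a - 1) N + b reads a N + b. *)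
Definition pair_idx (a b : 'I_N) : 'I_(N * N) := Ordinal (pair_idx_subproof a b).

Lemma quo_idx_subproof (i : 'I_(N * N)) : (i %/ N < N)%N.
Proof.
by case: N i => [[]//|n] i; rewrite ltn_divLR// ltn_ord.
Qed.

Lemma rem_idx_subproof (i : 'I_(N * N)) : (i %% N < N)%N.
Proof. by case: N i => [[]//|n] i; rewrite ltn_mod. Qed.

Definition quo_idx (i : 'I_(N * N)) : 'I_N := Ordinal (quo_idx_subproof i).
Definition rem_idx (i : 'I_(N * N)) : 'I_N := Ordinal (rem_idx_subproof i).

Definition phi_idx (p : idx2) : idx4 :=
  (quo_idx p.1, rem_idx p.1, quo_idx p.2, rem_idx p.2).

Definition phi_idx_inv (q : idx4) : idx2 :=
  let: (a, b, c, d) := q in (pair_idx a b, pair_idx c d).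

Lemma quo_pair_idx (a b : 'I_N) : quo_idx (pair_idx a b) = a.
Proof.
apply/val_inj => /=; have N0 : (0 < N)%N by apply: leq_ltn_trans (ltn_ord a).
by rewrite divnMDl// divn_small ?addn0.
Qed.

Lemma rem_pair_idx (a b : 'I_N) : rem_idx (pair_idx a b) = b.
Proof. by apply/val_inj => /=; rewrite modnMDl modn_small. Qed.

Lemma pair_quo_rem_idx (i : 'I_(N * N)) : pair_idx (quo_idx i) (rem_idx i) = i.
Proof. by apply/val_inj => /=; rewrite -divn_eq. Qed.

Lemma phi_idxK : cancel phi_idx phi_idx_inv.
Proof. by case=> i j; rewrite /phi_idx_inv/= !pair_quo_rem_idx. Qed.

Lemma phi_idx_invK : cancel phi_idx_inv phi_idx.
Proof.
by case=> [[[a b] c] d]; rewrite /phi_idx/= !quo_pair_idx !rem_pair_idx.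
Qed.

Lemma phi_idxP (i j : 'I_(N * N)) (a b c d : 'I_N) :
  phi_idx (i, j) = (a, b, c, d) <->
  (i = a * N + b :> nat)%N /\ (j = c * N + d :> nat)%N.
Proof.
split=> [/(congr1 phi_idx_inv)|[ij1 ij2]]; first by rewrite phi_idxK => -[-> ->].
have -> : (i, j) = phi_idx_inv (a, b, c, d) by congr pair; apply/val_inj.
exact: phi_idx_invK.
Qed.

Definition gamma_idx (q : idx4) : idx4 := let: (a, b, c, d) := q in (a, d, c, b).
Definition mu_idx (q : idx4) : idx4 := let: (a, b, c, d) := q in (a, c, b, d).

Lemma gamma_idxK : involutive gamma_idx. Proof. by case=> [[[]]]. Qed.
Lemma mu_idxK : involutive mu_idx. Proof. by case=> [[[]]]. Qed.

Lemma partial_transpose_inj : injective (phi_idx_inv \o gamma_idx \o phi_idx).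
Proof.
exact: inj_comp (inj_comp (can_inj phi_idx_invK) (inv_inj gamma_idxK))
                (can_inj phi_idxK).
Qed.

Lemma mixing_map_inj : injective (phi_idx_inv \o mu_idx \o phi_idx).
Proof.
exact: inj_comp (inj_comp (can_inj phi_idx_invK) (inv_inj mu_idxK))
                (can_inj phi_idxK).
Qed.

Definition partial_transpose : {perm 'I_(N * N) * 'I_(N * N)} :=
  perm partial_transpose_inj.
Definition mixing_map : {perm 'I_(N * N) * 'I_(N * N)} := perm mixing_map_inj.

End EntryPermutations.

Section RandomMatrices.
Context (d : measure_display) (T : measurableType d) (R : realType)
        (P : probability T R).

(* C = R[i] carries the Borel sigma-algebra of R^2, through (Re, Im). *)
Definition Re_Im (X : T -> R[i]) (w : T) : R * R := (complex.Re (X w), complex.Im (X w)).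

Definition cintegrable (X : T -> R[i]) : Prop :=
  P.-integrable setT (EFin \o (fun w => complex.Re (X w))) /\
  P.-integrable setT (EFin \o (fun w => complex.Im (X w))).

Definition cexpectation (X : T -> R[i]) : R[i] :=
  Complex (fine 'E_P[fun w => complex.Re (X w)]) (fine 'E_P[fun w => complex.Im (X w)]).

Definition independent_family (I : finType) (D : {set I}) (X : I -> T -> R[i]) :
    Prop :=
  forall (J : {set I}) (B : I -> set (R * R)),
    J \subset D -> (forall k, measurable (B k)) ->
    P (\bigcap_(k in [set` J]) (Re_Im (X k) @^-1` B k)) =
    (\prod_(k in J) P (Re_Im (X k) @^-1` B k))%E.

(* The degenerate laws are listed apart because [normal_prob m 0] is not the
   Dirac mass at m. *)
Definition real_gaussian (X : T -> R) : Prop :=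
  measurable_fun setT X /\
  ((exists m s : R, 0 < s /\
      forall B, measurable B -> P (X @^-1` B) = normal_prob m s B) \/
   (exists m : R, forall B, measurable B -> P (X @^-1` B) = dirac m B)).

(* (Re X, Im X) is jointly Gaussian: all its real linear combinations are. *)
Definition complex_gaussian (X : T -> R[i]) : Prop :=
  forall a b : R, real_gaussian (fun w => a * complex.Re (X w) + b * complex.Im (X w)).

Definition gaussian_matrix (n : nat) (G : T -> 'M[R[i]]_n) : Prop :=
  [/\ forall w i j, G w i j = (G w j i)^*,
      independent_family [set k : 'I_n * 'I_n | (k.1 <= k.2)%N]
        (fun k w => G w k.1 k.2),
      forall i, real_gaussian (fun w => complex.Re (G w i i)),
      forall i j, i != j -> complex_gaussian (fun w => G w i j) /\
        cexpectation (fun w => G w i j ^+ 2) = 0 &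
      forall i j, cexpectation (fun w => G w i j) = 0 /\
        cexpectation (fun w => `|G w i j| ^+ 2) = n%:R^-1].

End RandomMatrices.

(* The algebra is an [algType], hence nontrivial; this is no restriction, since
   a unital functional does not exist on the zero algebra. Positivity uses the
   order of C, for which 0 <= z means that z is real and nonnegative. *)
Record ncps (C : numClosedFieldType) := NCPS {
  ncps_alg :> algType C;
  ncps_star : ncps_alg -> ncps_alg;
  ncps_state : {scalar ncps_alg};
  ncps_starD : {morph ncps_star : x y / x + y};
  ncps_starZ : forall (c : C) x, ncps_star (c *: x) = c^* *: ncps_star x;
  ncps_starM : forall x y, ncps_star (x * y) = ncps_star y * ncps_star x;
  ncps_starK : involutive ncps_star;
  ncps_state1 : ncps_state 1 = 1;
  ncps_state_ge0 : forall x, 0 <= ncps_state (ncps_star x * x)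
}.

Section Freeness.
Context (C : numClosedFieldType) (S : ncps C).

(* [horner_alg a p] is p(a): freeness is that of the unital algebras generated by
   the family, not of the unital *-algebras. *)
Definition unital_subalgebra (a : S) : set S :=
  [set x | exists p : {poly C}, x = horner_alg a p].

Definition free_family (I : Type) (a : I -> S) : Prop :=
  forall (r : nat) (k : 'I_r -> I) (x : 'I_r -> S), (0 < r)%N ->
    (forall s t : 'I_r, t = s.+1 :> nat -> k s <> k t) ->
    (forall s, unital_subalgebra (a (k s)) (x s)) ->
    (forall s, ncps_state S (x s) = 0) ->
    ncps_state S (\prod_(s < r) x s) = 0.

End Freeness.

Definition normalized_trace (F : fieldType) (n : nat) (A : 'M[F]_n) : F :=
  n%:R^-1 * \tr A.

(* The matrices of size n N are allowed to live on a probability space that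
   depends on N. The clause [cintegrable] states that the expectations of the
   clause after it exist, since [cexpectation] is a total function. *)
Definition asymptotically_free (R : realType) (d : nat -> measure_display)
    (T : forall N, measurableType (d N)) (P : forall N, probability (T N) R)
    (n : nat -> nat) (M : nat) (A : 'I_M -> forall N, T N -> 'M[R[i]]_(n N)) :
    Prop :=
  exists (S : ncps R[i]) (a : 'I_M -> S), free_family a /\
    forall (r : nat) (k : 'I_r -> 'I_M), (0 < r)%N ->
      let m N (w : T N) := normalized_trace (\prod_(s < r) A (k s) N w) in
      (forall N, cintegrable (P N) (m N)) /\
      (fun N => cexpectation (P N) (m N)) @ \oo -->
        ncps_state S (\prod_(s < r) a (k s)).

(* Main.v *)
(* In the limit G and its partial transpose become free semicircular elements,
   whereas every moment of a word containing the mixed matrix vanishes.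

   By Wick's formula the moment of a word is a sum over pairings of its letters.
   Reading the word from left to right, a pairing is a history of a stack: each
   letter is pushed or paired with one of the open letters.  A pushed letter
   leaves a new index in [N^2] free, and a paired letter determines its column
   index, which bounds the contribution of every pairing by O(1).  A letter that
   closes the top of the stack, when the two are equal and not mixed, contributes
   exactly 1 after summation over the index they share.  Every other first
   closing constrains an index that was free, and a factor N is lost.  The
   surviving histories are those that compute the vacuum moments of the operators
   l_k + l_k^* on the full Fock space (for k = 0, 1); the mixed matrix, never
   paired in the limit, is represented by an annihilation operator.

   The Wick formula comes from the factorisation of moments over independent
   entries and from the law of all the real linear combinations of (Re g, Im g),
   which determines E[g^p conj(g)^q] through a polynomial identity. *)

(* The index shared by the top of the stack and the next letter is what makes the closings
   tractable. While no pair has been closed it runs freely; a good closing sums it out and leaves a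
   state of the same kind with a shorter stack, so the analysis goes on exactly, while after any
   other closing a crude bound on what follows is enough. All covariances are nonnegative, so no
   cancellation has to be controlled, and an error of order N is negligible against a main term of
   order N^2.

   The Fock side obeys literally the same recursion: moved to the other side of the inner product,
   the annihilation part of a limit operator pushes a letter on a basis word and the creation part
   pops one.

   For N > 1 the mixed matrix is not Hermitian: the mixing map does not commute with the exchange of
   rows and columns. Hence its moments without adjoints can vanish although the normalized trace of
   its product with its adjoint has expectation 1. The limit operator chosen for it reproduces the
   former and not all moments with adjoints; freeness, which concerns polynomials without stars,
   allows this. *)
From HB Require Import structures.
Require Import Defs.
From mathcomp Require Import all_boot all_order all_algebra fingroup perm.
From mathcomp Require Import all_classical all_reals all_analysis.
From mathcomp Require Import complex ring lra zify measurable_realfun.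
Set Implicit Arguments.
Unset Strict Implicit.
Unset Printing Implicit Defensive.
Import Order.TTheory GRing.Theory Num.Theory.
Import numFieldNormedType.Exports.
Local Open Scope classical_set_scope.
Local Open Scope ring_scope.

(** * Change of measure and independence *)

Section Reweight.
Local Open Scope ereal_scope.
Context d1 d2 (X : measurableType d1) (Y : measurableType d2) (R : realType).
Variables (mu : {measure set X -> \bar R}) (nu : {measure set Y -> \bar R}).
Variables (phi : X -> Y) (w : X -> R).
Hypothesis mphi : measurable_fun setT phi.
Hypothesis mw : measurable_fun setT w.
Hypothesis w0 : forall x, (0 <= w x)%R.
Hypothesis nuE : forall B, measurable B ->
  nu B = \int[mu]_(x in phi @^-1` B) (w x)%:E.

Import HBNNSimple.

(** [nu] is the image under [phi] of the measure of density [w]. This form serves three times: for a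
    law ([w] constant 1), for a normal distribution ([phi] the identity), and in the independence
    argument, where [w] is the product of the other factors. *)
Lemma ge0_integral_reweight (f : Y -> \bar R) : measurable_fun setT f ->
  (forall y, 0 <= f y) -> \int[nu]_y f y = \int[mu]_x ((w x)%:E * f (phi x)).
Proof.
move=> mf f0.
pose f_ := nnsfun_approx measurableT mf.
have fphi y : (f_ n y)%:E @[n --> \oo] --> f y.
  by apply: cvg_nnsfun_approx.
have mfphi n : measurable_fun setT (fun x => (f_ n (phi x))%:E).
  by apply/measurable_EFinP; apply: (measurableT_comp _ mphi).
transitivity (limn (fun n => \int[nu]_x (f_ n x)%:E)).
  rewrite -monotone_convergence//.
  - by apply: eq_integral => y _; apply/esym/cvg_lim => //; exact: fphi.
  - by move=> n; exact/measurable_EFinP/measurable_funP.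
  - by move=> n y _; rewrite lee_fin.
  - by move=> y _ m n mn; rewrite lee_fin; exact/lefP/nd_nnsfun_approx.
have mwE : measurable_fun setT (EFin \o w) by exact/measurable_EFinP.
rewrite [X in limn X](_ : _ =
    (fun n => \int[mu]_x ((w x)%:E * (f_ n (phi x))%:E))).
  rewrite -monotone_convergence//.
  - apply: eq_integral => x _; apply/cvg_lim => //.
    exact: (cvgeZl (y := (w x)%:E) isT (fphi (phi x))).
  - by move=> n; exact: emeasurable_funM.
  - by move=> n x _; rewrite mule_ge0// lee_fin.
  - move=> x _ m n mn; rewrite lee_wpmul2l// ?lee_fin//.
    exact/lefP/nd_nnsfun_approx.
apply/funext => n.
have mB r : measurable (f_ n @^-1` [set r]) by [].
have mphiB r : measurable (phi @^-1` (f_ n @^-1` [set r])).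
  by rewrite -[X in measurable X]setTI; exact: mphi.
pose ind k : X -> R := \1_(phi @^-1` (f_ n @^-1` [set k])).
have ind0 k x : (0 <= ind k x)%R by rewrite /ind indicE.
have mind k : measurable_fun setT (fun x => (w x)%:E * (ind k x)%:E).
  by apply: emeasurable_funM => //; exact/measurable_EFinP/measurable_indic.
transitivity (\sum_(k \in range (f_ n)) k%:E * nu (f_ n @^-1` [set k])).
  by rewrite integralT_nnsfun sintegralE.
transitivity (\sum_(k \in range (f_ n))
    \int[mu]_x (k%:E * ((w x)%:E * (ind k x)%:E))).
  apply: eq_fsbigr => r; rewrite inE => -[y _ fy].
  rewrite nuE// integral_mkcond epatch_indic ge0_integralZl//.
  - by move=> x _ /=; rewrite -EFinM lee_fin mulr_ge0.
  - by rewrite -fy lee_fin.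
(* Nonnegativity is wanted for every real [k], negative ones included; for these the indicator
   vanishes because [f_ n] is nonnegative. *)
have kE k x : (k * ind k x)%R = (f_ n (phi x) * ind k x)%R.
  rewrite /ind indicE; case: (boolP (_ \in _)); last by rewrite !mulr0.
  by rewrite inE /= => ->.
have k0 k x : 0 <= k%:E * ((w x)%:E * (ind k x)%:E).
  by rewrite muleCA -EFinM kE lee_fin !mulr_ge0.
rewrite -ge0_integral_fsum//.
- apply: eq_integral => x _.
  under eq_fsbigr do rewrite muleCA.
  rewrite -ge0_mule_fsumr; last first.
    by move=> k; rewrite -EFinM kE lee_fin mulr_ge0.
  under eq_fsbigr do rewrite -EFinM.
  by rewrite fsumEFin// [in RHS](fimfunE (f_ n) (phi x)).
- by move=> k; apply: emeasurable_funM.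
Qed.

Lemma integral_reweight (f : Y -> R) : measurable_fun setT f ->
  \int[nu]_y (f y)%:E = \int[mu]_x (w x * f (phi x))%:E.
Proof.
move=> mf; rewrite integralE [RHS]integralE.
have mfE : measurable_fun setT (EFin \o f) by exact/measurable_EFinP.
rewrite !ge0_integral_reweight//; last 2 first.
- exact: measurable_funeneg.
- exact: measurable_funepos.
congr (_ - _); apply: eq_integral => x _.
- by rewrite !funeposE -!EFin_max -EFinM maxr_pMr// mulr0.
- by rewrite !funenegE /= -!EFin_max -EFinM maxr_pMr// mulr0 mulrN.
Qed.

Lemma integrable_reweight (f : Y -> R) : measurable_fun setT f ->
  nu.-integrable setT (EFin \o f) <->
  mu.-integrable setT (fun x => (w x * f (phi x))%:E).
Proof.
move=> mf.
have mwf : measurable_fun setT (fun x => (w x * f (phi x))%:E).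
  apply/measurable_EFinP; apply: measurable_funM => //.
  exact: measurableT_comp.
have fE : \int[nu]_y `|(f y)%:E| = \int[mu]_x `|(w x * f (phi x))%:E|.
  rewrite ge0_integral_reweight//.
  - by apply: eq_integral => x _; rewrite EFinM abseM (gee0_abs (x := (w x)%:E)) ?lee_fin.
  - by apply/measurable_EFinP; exact: measurableT_comp.
split=> /integrableP[_ lt]; apply/integrableP; split => //.
- by rewrite -fE.
- exact/measurable_EFinP.
- by rewrite fE.
Qed.

End Reweight.

Section Independence.
Context d dY (T : measurableType d) (Y : measurableType dY) (R : realType)
        (P : probability T R) (I : finType) (D : {set I}) (X : I -> T -> Y).
Hypothesis mX : forall k, measurable_fun setT (X k).
Hypothesis indX : forall B : I -> set Y, (forall k, measurable (B k)) ->
  P (\bigcap_(k in [set` D]) (X k @^-1` B k)) =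
  (\prod_(k in D) P (X k @^-1` B k))%E.

Let mXB k (B : set Y) : measurable B -> measurable (X k @^-1` B).
Proof. by move=> mB; rewrite -[_ @^-1` _]setTI; exact: mX. Qed.

(** [A] contains the indices whose factor may fail to be an indicator. Putting an arbitrary [\1_B]
    at [a] shrinks [A]; the induction hypothesis then says that weighting by the product [Z] of the
    other factors multiplies the law of [X a] by a constant, and [g a] can be integrated against
    it. *)
Lemma ge0_integral_prod_indep (A : {set I}) (g : I -> Y -> R) (c : I -> R) :
  A \subset D ->
  (forall k, k \in D -> k \notin A -> exists2 B, measurable B & g k = \1_B) ->
  (forall k, measurable_fun setT (g k)) -> (forall k y, 0 <= g k y) ->
  (forall k, \int[P]_w (g k (X k w))%:E = (c k)%:E)%E ->
  (\int[P]_w (\prod_(k in D) g k (X k w))%:E = (\prod_(k in D) c k)%:E)%E.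
Proof.
have [n] := ubnP #|A|; elim: n => // n IH in A g c *.
rewrite ltnS => An AD gind mg g0 gc.
have [A0|[a aA]] := set_0Vmem A.
  have /choice[B BP] : forall k, exists B, measurable B /\ (k \in D -> g k = \1_B).
    move=> k; have [kD|kD] := boolP (k \in D); last by exists setT.
    by have [|B mB gB] := gind k kD; [rewrite A0 inE|exists B].
  have cB k : k \in D -> (c k)%:E = P (X k @^-1` B k).
    move=> kD; rewrite -gc (BP k).2//.
    transitivity (\int[P]_w (\1_(X k @^-1` B k) w)%:E)%E => //.
    by rewrite integral_indic ?setIT//; apply: mXB; exact: (BP k).1.
  rewrite -prodEFin (eq_bigr _ cB).
  rewrite -indX; last by move=> k; exact: (BP k).1.
  transitivity (\int[P]_w (\1_(\bigcap_(k in [set` D]) (X k @^-1` B k)) w)%:E)%E.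
    apply: eq_integral => w _; congr EFin.
    rewrite (eq_bigr (fun k => \1_(B k) (X k w))); last by move=> k /(BP k).2 ->.
    rewrite indicE; case: (boolP (w \in _)) => [|].
      rewrite inE => wB; rewrite big1// => k kD.
      by rewrite indicE mem_set//; exact: wB.
    move=> /negP; rewrite inE => wB; apply/eqP; rewrite prodf_seq_eq0.
    apply/hasP; apply: contrapT => h; apply: wB => k /= kD.
    apply: contrapT => Xk; apply: h; exists k; first by rewrite mem_index_enum.
    by rewrite kD/= indicE memNset.
  rewrite integral_indic ?setIT//; apply: fin_bigcap_measurable => // k _.
  by apply: mXB; exact: (BP k).1.
have aD : a \in D by apply: (fintype.subsetP AD).
pose upd (h : Y -> R) k := if k == a then h else g k.
pose Z w := \prod_(k in D | k != a) g k (X k w).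
pose cZ := \prod_(k in D | k != a) c k.
have mZ : measurable_fun setT Z.
  rewrite (_ : Z = fun w => \prod_(k <- [seq k <- index_enum I |
    (k \in D) && (k != a)]) g k (X k w)); last first.
    by apply/funext => w; rewrite big_filter.
  by apply: measurable_prod => k _; exact: measurableT_comp.
have c0 k : 0 <= c k.
  by rewrite -lee_fin -gc integral_ge0// => w _; rewrite lee_fin.
have cZ0 : 0 <= cZ by apply: prodr_ge0.
have Z0 w : 0 <= Z w by apply: prodr_ge0.
have ZB (B : set Y) : measurable B ->
    (\int[P]_(w in X a @^-1` B) (Z w)%:E = cZ%:E * P (X a @^-1` B))%E.
  move=> mB.
  pose c' k := if k == a then fine (P (X a @^-1` B)) else c k.
  have fP : P (X a @^-1` B) \is a fin_num by rewrite fin_num_measure//; exact: mXB.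
  have : (\int[P]_w (\prod_(k in D) upd \1_B k (X k w))%:E =
          (\prod_(k in D) c' k)%:E)%E.
    rewrite (cardsD1 a) aA add1n in An.
    apply: (IH (A :\ a)) => //; rewrite /upd /c'.
    - exact: fintype.subset_trans (finset.subD1set _ _) AD.
    - move=> k kD; rewrite !inE negb_and negbK; case: eqP => [_ _|_ /= kA].
        by exists B.
      exact: gind.
    - by move=> k; case: eqP => // _; exact: measurable_indic.
    - by move=> k y; case: eqP => // _; rewrite indicE.
    - move=> k; case: eqP => // ->; rewrite fineK//.
      transitivity (\int[P]_w (\1_(X a @^-1` B) w)%:E)%E => //.
      by rewrite integral_indic ?setIT//; exact: mXB.
  rewrite [in RHS](bigD1 a)//= /c' eqxx EFinM fineK// muleC => IHE.
  rewrite integral_mkcond epatch_indic.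
  transitivity (\int[P]_w (\prod_(k in D) upd \1_B k (X k w))%:E)%E.
    apply: eq_integral => w _; rewrite (bigD1 a)//= /upd eqxx mulrC EFinM.
    congr (_%:E * _%:E)%E; apply: eq_bigr => k /andP[_ /negbTE ->] //.
  rewrite IHE; congr (_ * _)%E; congr EFin.
  by apply: eq_bigr => k /andP[_ /negbTE ->].
pose Xa : {mfun T >-> Y} := HB.pack (X a) (isMeasurableFun.Build _ _ _ _ (X a) (mX a)).
pose nu := mscale (NngNum cZ0) (distribution P Xa).
have : (\int[nu]_y (g a y)%:E = \int[P]_w ((Z w)%:E * (g a (X a w))%:E))%E.
  apply: (ge0_integral_reweight (mX a)) => //.
  - by move=> B mB; rewrite ZB.
  - exact/measurable_EFinP.
  - by move=> y; rewrite lee_fin.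
rewrite ge0_integral_mscale//=; last 2 first.
- exact/measurable_EFinP.
- by move=> y _; rewrite lee_fin.
rewrite ge0_integral_distribution//=; last 2 first.
- exact/measurable_EFinP.
- by move=> y; rewrite lee_fin.
rewrite gc => E.
rewrite (bigD1 a)//= EFinM muleC E; apply: eq_integral => w _.
by rewrite (bigD1 a)//= mulrC EFinM.
Qed.

End Independence.

(** * Expectation of complex random variables *)

Section ComplexExpectation.
Context d (T : measurableType d) (R : realType) (P : probability T R).
Implicit Types (X Y : T -> R[i]) (c : R[i]).

Lemma cexpectationE X : cexpectation P X =
  Complex (\int[P]_w complex.Re (X w)) (\int[P]_w complex.Im (X w)).
Proof. by rewrite /cexpectation unlock. Qed.

Lemma Re_complexD (x y : R[i]) : complex.Re (x + y) = complex.Re x + complex.Re y.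
Proof. by case: x; case: y. Qed.

Lemma Im_complexD (x y : R[i]) : complex.Im (x + y) = complex.Im x + complex.Im y.
Proof. by case: x; case: y. Qed.

Lemma Re_complexM (x y : R[i]) :
  complex.Re (x * y) = complex.Re x * complex.Re y - complex.Im x * complex.Im y.
Proof. by case: x; case: y. Qed.

Lemma Im_complexM (x y : R[i]) :
  complex.Im (x * y) = complex.Re x * complex.Im y + complex.Im x * complex.Re y.
Proof. by case: x; case: y. Qed.

Lemma integrable_EFinD (f g : T -> R) : P.-integrable setT (EFin \o f) ->
  P.-integrable setT (EFin \o g) ->
  P.-integrable setT (EFin \o (fun w => f w + g w)).
Proof. by move=> fi gi; exact: (@integrableD _ _ _ P _ measurableT _ _ fi gi). Qed.

Lemma integrable_EFinZ (a : R) (f : T -> R) : P.-integrable setT (EFin \o f) ->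
  P.-integrable setT (EFin \o (fun w => a * f w)).
Proof. by move=> fi; exact: (@integrableZl _ _ _ P _ measurableT a _ fi). Qed.

Lemma cintegrableD X Y : cintegrable P X -> cintegrable P Y ->
  cintegrable P (fun w => X w + Y w).
Proof.
move=> [Xr Xi] [Yr Yi]; split.
- by under eq_fun do rewrite Re_complexD; exact: integrable_EFinD.
- by under eq_fun do rewrite Im_complexD; exact: integrable_EFinD.
Qed.

Lemma cintegrableZ c X : cintegrable P X -> cintegrable P (fun w => c * X w).
Proof.
move=> [Xr Xi]; split.
- under eq_fun do rewrite Re_complexM -mulNr.
  by apply: integrable_EFinD; exact: integrable_EFinZ.
- under eq_fun do rewrite Im_complexM.
  by apply: integrable_EFinD; exact: integrable_EFinZ.
Qed.

Lemma cexpectationD X Y : cintegrable P X -> cintegrable P Y ->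
  cexpectation P (fun w => X w + Y w) = cexpectation P X + cexpectation P Y.
Proof.
move=> [Xr Xi] [Yr Yi]; rewrite !cexpectationE.
under eq_Rintegral do rewrite Re_complexD.
under [X in Complex _ X]eq_Rintegral do rewrite Im_complexD.
by rewrite !RintegralD.
Qed.

Lemma cexpectationZ c X : cintegrable P X ->
  cexpectation P (fun w => c * X w) = c * cexpectation P X.
Proof.
move=> [Xr Xi]; rewrite !cexpectationE.
under eq_Rintegral do rewrite Re_complexM -mulNr.
under [X in Complex _ X]eq_Rintegral do rewrite Im_complexM.
rewrite !RintegralD ?RintegralZl//; try exact: integrable_EFinZ.
by case: c => a b /=; rewrite mulNr.
Qed.

Lemma cintegrable_cst c : cintegrable P (cst c).
Proof.
by split; exact: finite_measure_integrable_cst.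
Qed.

Lemma cexpectation_cst c : cexpectation P (cst c) = c.
Proof. by rewrite /cexpectation !expectation_cst; case: c. Qed.

Lemma cintegrable_sum I (s : seq I) (X : I -> T -> R[i]) :
  (forall i, cintegrable P (X i)) ->
  cintegrable P (fun w => \sum_(i <- s) X i w).
Proof.
move=> Xi; elim: s => [|i s IH].
  by under eq_fun do rewrite big_nil; exact: cintegrable_cst.
by under eq_fun do rewrite big_cons; exact: cintegrableD.
Qed.

Lemma cexpectation_sum I (s : seq I) (X : I -> T -> R[i]) :
  (forall i, cintegrable P (X i)) ->
  cexpectation P (fun w => \sum_(i <- s) X i w) =
  \sum_(i <- s) cexpectation P (X i).
Proof.
move=> Xi; elim: s => [|i s IH].
  by under eq_fun do rewrite big_nil; rewrite big_nil; exact: cexpectation_cst.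
under eq_fun do rewrite big_cons.
by rewrite big_cons cexpectationD ?IH//; exact: cintegrable_sum.
Qed.

End ComplexExpectation.

Section ComplexIndependence.
Context d dY (T : measurableType d) (Y : measurableType dY) (R : realType)
        (P : probability T R) (I : finType) (D : {set I}) (X : I -> T -> Y).
Hypothesis mX : forall k, measurable_fun setT (X k).
Hypothesis indX : forall B : I -> set Y, (forall k, measurable (B k)) ->
  P (\bigcap_(k in [set` D]) (X k @^-1` B k)) =
  (\prod_(k in D) P (X k @^-1` B k))%E.

Let E (f : Y -> R[i]) k := cexpectation P (f \o X k).

(* Each factor is a combination of four nonnegative functions (the positive and
   negative parts of its real and imaginary parts); [A] contains the indices of
   the factors that remain to be decomposed. *)
Let cexpectation_prod_indep_subset (A : {set I}) (f : I -> Y -> R[i]) :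
  A \subset D ->
  (forall k, k \notin A -> exists2 g : Y -> R,
    (forall y, 0 <= g y) & forall y, f k y = (g y)%:C%C) ->
  (forall k, measurable_fun setT (fun y => complex.Re (f k y))) ->
  (forall k, measurable_fun setT (fun y => complex.Im (f k y))) ->
  (forall k, cintegrable P (f k \o X k)) ->
  cintegrable P (fun w => \prod_(k in D) f k (X k w)) /\
  cexpectation P (fun w => \prod_(k in D) f k (X k w)) = \prod_(k in D) E (f k) k.
Proof.
have [n] := ubnP #|A|; elim: n => // n IH in A f *.
rewrite ltnS => An AD freal mRe mIm fi.
have [A0|[a aA]] := set_0Vmem A.
  have /choice[g gP] : forall k, exists g : Y -> R,
      (forall y, 0 <= g y) /\ (forall y, f k y = (g y)%:C%C).
    by move=> k; have [|g g0 fg] := freal k; [rewrite A0 inE|exists g].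
  have g0 k : forall y, 0 <= g k y := (gP k).1.
  have fg k : forall y, f k y = (g k y)%:C%C := (gP k).2.
  have mg k : measurable_fun setT (g k).
    by have := mRe k; under eq_fun do rewrite fg/=.
  have gi k : P.-integrable setT (EFin \o (g k \o X k)).
    have [] := fi k; rewrite /comp; under eq_fun do rewrite fg/=.
    by [].
  have fin k : (\int[P]_w (g k (X k w))%:E = (\int[P]_w g k (X k w))%:E)%E.
    by rewrite fineK// (integrable_fin_num _ (gi k)).
  have mprod : measurable_fun setT (fun w => \prod_(k in D) g k (X k w)).
    under eq_fun do rewrite -big_filter.
    by apply: measurable_prod => k _; exact: measurableT_comp.
  have prod0 w : 0 <= \prod_(k in D) g k (X k w) by apply: prodr_ge0.
  have prodE : (\int[P]_w (\prod_(k in D) g k (X k w))%:E =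
      (\prod_(k in D) \int[P]_w g k (X k w))%:E)%E.
    apply: (ge0_integral_prod_indep mX indX (A := D)) => //.
    by move=> k ->.
  have fE w : \prod_(k in D) f k (X k w) = (\prod_(k in D) g k (X k w))%:C%C.
    by under eq_bigr do rewrite fg; rewrite rmorph_prod.
  under [in cintegrable _ _]eq_fun do rewrite fE.
  under [in cexpectation _ _]eq_fun do rewrite fE.
  split; first split => //=.
  - apply/integrableP; split; first exact/measurable_EFinP.
    under eq_integral do rewrite /= ger0_norm//.
    by rewrite prodE ltry.
  - exact: finite_measure_integrable_cst.
  - rewrite cexpectationE/= Rintegral_cst// mul0r /Rintegral prodE/=.
    rewrite -[LHS]/((\prod_(k in D) \int[P]_w g k (X k w))%:C%C) rmorph_prod.
    apply: eq_bigr => k _; rewrite /E (_ : f k \o X k = fun w => (g k (X k w))%:C%C).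
      by rewrite cexpectationE/= Rintegral_cst// mul0r.
    by apply/funext => w; exact: fg.
have aD : a \in D by apply: (fintype.subsetP AD).
pose upd (h : Y -> R[i]) k := if k == a then h else f k.
pose part (j : 'I_4) (y : Y) : R := match val j with
  | 0 => Num.max (complex.Re (f a y)) 0
  | 1 => Num.max (- complex.Re (f a y)) 0
  | 2 => Num.max (complex.Im (f a y)) 0
  | _ => Num.max (- complex.Im (f a y)) 0 end.
pose om (j : 'I_4) : R[i] :=
  match val j with 0 => 1 | 1 => -1 | 2 => Complex 0 1 | _ => Complex 0 (-1) end.
have maxD (x : R) : Num.max x 0 - Num.max (- x) 0 = x.
  by case: (lerP x 0) => x0; case: (lerP (- x) 0) => x1; lra.
have faE y : f a y = \sum_(j < 4) om j * (part j y)%:C%C.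
  rewrite !big_ord_recl big_ord0 /om /part /=.
  rewrite addr0; apply/eqP; rewrite eq_complex/=.
  by rewrite !(mul0r, mulr0, mul1r, subr0, sub0r, oppr0, addr0, add0r, mulN1r)
    /= !maxD !eqxx.
have part0 j y : 0 <= part j y.
  by rewrite /part; case: (val j) => [|[|[|]]] *; rewrite le_max lexx orbT.
have mpart j : measurable_fun setT (part j).
  rewrite /part; case: (val j) => [|[|[|_]]].
  - exact: (measurable_funrpos (mRe a)).
  - exact: (measurable_funrneg (mRe a)).
  - exact: (measurable_funrpos (mIm a)).
  - exact: (measurable_funrneg (mIm a)).
have ipart j : cintegrable P (fun w => (part j (X a w))%:C%C).
  have [fr fi'] := fi a; split; last exact: finite_measure_integrable_cst.
  rewrite /part/=; case: (val j) => [|[|[|_]]].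
  - exact: (integrable_funrpos measurableT fr).
  - exact: (integrable_funrneg measurableT fr).
  - exact: (integrable_funrpos measurableT fi').
  - exact: (integrable_funrneg measurableT fi').
pose F j w := \prod_(k in D) upd (fun y => (part j y)%:C%C) k (X k w).
have IHj j : cintegrable P (F j) /\ cexpectation P (F j) =
    \prod_(k in D) E (upd (fun y => (part j y)%:C%C) k) k.
  apply: (IH (A :\ a)).
  - by move: An; rewrite (cardsD1 a) aA add1n.
  - exact: fintype.subset_trans (finset.subD1set _ _) AD.
  - move=> k; rewrite !inE negb_and negbK /upd; case: eqP => [_ _|_ /= kA].
      by exists (part j).
    exact: freal.
  - by move=> k; rewrite /upd; case: eqP => //= _.
  - by move=> k; rewrite /upd; case: eqP => //= _.
  - by move=> k; rewrite /upd; case: eqP => [->|_]//=; exact: ipart.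
have fF w : \prod_(k in D) f k (X k w) = \sum_(j < 4) om j * F j w.
  rewrite (bigD1 a)//= faE mulr_suml; apply: eq_bigr => j _.
  rewrite /F [in RHS](bigD1 a)//= /upd eqxx mulrA; congr (_ * _).
  by apply: eq_bigr => k /andP[_ /negbTE ->].
under [in cintegrable _ _]eq_fun do rewrite fF.
under [in cexpectation _ _]eq_fun do rewrite fF.
have iF j : cintegrable P (fun w => om j * F j w).
  by apply: cintegrableZ; exact: (IHj j).1.
split; first exact: cintegrable_sum.
rewrite cexpectation_sum//.
rewrite (eq_bigr (fun j => om j *
  \prod_(k in D) E (upd (fun y => (part j y)%:C%C) k) k)); last first.
  by move=> j _; rewrite cexpectationZ ?(IHj j).2//; exact: (IHj j).1.
rewrite (bigD1 a)//=.
have -> : E (f a) a = \sum_(j < 4) om j * E (fun y => (part j y)%:C%C) a.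
  rewrite /E (_ : f a \o X a =
      fun w => \sum_(j < 4) om j * (part j (X a w))%:C%C); last first.
    by apply/funext => w; exact: faE.
  rewrite cexpectation_sum; last by move=> j; exact: cintegrableZ.
  by apply: eq_bigr => j _; rewrite cexpectationZ.
rewrite mulr_suml; apply: eq_bigr => j _.
rewrite [in LHS](bigD1 a)//= {1}/upd eqxx mulrA; congr (_ * _).
by apply: eq_bigr => k /andP[_ /negbTE]; rewrite /upd => ->.
Qed.

Lemma cexpectation_prod_indep (f : I -> Y -> R[i]) :
  (forall k, measurable_fun setT (fun y => complex.Re (f k y))) ->
  (forall k, measurable_fun setT (fun y => complex.Im (f k y))) ->
  (forall k, cintegrable P (f k \o X k)) ->
  cintegrable P (fun w => \prod_(k in D) f k (X k w)) /\
  cexpectation P (fun w => \prod_(k in D) f k (X k w)) =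
  \prod_(k in D) cexpectation P (f k \o X k).
Proof.
move=> mRe mIm fi.
(* With [A = D] the factors outside [D] have to be real and nonnegative; they are replaced by 0. *)
pose g k y : R[i] := if k \in D then f k y else 0.
have gf k : k \in D -> g k = f k by rewrite /g => ->.
have g0 k : k \notin D -> g k = fun=> 0 by rewrite /g => /negbTE ->.
have [//|k kD|k|k|k|] := @cexpectation_prod_indep_subset D g.
- by exists (fun=> 0) => // y; rewrite g0.
- by have [kD|kD] := boolP (k \in D); [rewrite gf|rewrite g0].
- by have [kD|kD] := boolP (k \in D); [rewrite gf|rewrite g0].
- by have [kD|kD] := boolP (k \in D); [rewrite gf|rewrite g0//; exact: cintegrable_cst].
rewrite (_ : (fun w => \prod_(k in D) g k (X k w)) =
             (fun w => \prod_(k in D) f k (X k w))); last first.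
  by apply/funext => w; apply: eq_bigr => k /gf ->.
by move=> fint ->; split => //; apply: eq_bigr => k /gf ->.
Qed.

End ComplexIndependence.

(** * Moments of Gaussian variables *)

Section IntegralOfDerivative.
Context (R : realType).
Notation mu := (@lebesgue_measure R).

(** On [-n, n] the integral is [F n - F (-n)] by the fundamental theorem of calculus; dominated
    convergence extends it to the line. *)
Lemma integral_derive_eq0 (F f : R -> R) :
  (forall x, is_derive x (1:R) F (f x)) -> continuous f ->
  mu.-integrable setT (EFin \o f) ->
  F n%:R @[n --> \oo] --> 0 -> F (- n%:R) @[n --> \oo] --> 0 ->
  (\int[mu]_x (f x)%:E = 0)%E.
Proof.
move=> dF cf fint Fp Fn.
pose f_ (n : nat) x := (f x * \1_(`[- n%:R, n%:R]%classic : set R) x)%:E.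
have mf : measurable_fun setT f by exact: continuous_measurable_fun.
have [] := @dominated_convergence _ _ _ mu setT measurableT f_ (EFin \o f)
  (fun x => `|(f x)%:E|)%E.
- by move=> n; apply/measurable_EFinP; exact: measurable_funM.
- exact/measurable_EFinP.
- apply/aeW => x _.
  apply: (@cvg_near_cst _ _ _ _ _) => //.
  near=> n; rewrite /f_ indicE mem_set ?mulr1//=.
  rewrite in_itv/= -ler_norml.
  near: n; exact: nbhs_infty_ger.
- exact: (integrable_abse fint).
- apply/aeW => x n _; rewrite /f_ /= lee_fin normrM ler_piMr//.
  by rewrite indicE; case: (_ \in _); rewrite ?normr1// normr0.
move=> _ _ /= f_cvg.
apply: (cvg_unique _ f_cvg) => //.
have dFx x : derivable F x 1 by apply: ex_derive; exact: dF.
have cF : continuous F.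
  by move=> x; exact/differentiable_continuous/derivable1_diffP/dFx.
apply: (@cvg_trans _ ((F n%:R - F (- n%:R))%:E @[n --> \oo])); last first.
  apply: cvg_EFin; first by apply: nearW.
  by rewrite -[0]subr0; apply: cvgB.
apply: near_eq_cvg; near=> n.
have n0 : - n%:R < n%:R :> R.
  rewrite gtrN// ltr0n; near: n; exact: nbhs_infty_gt.
transitivity (\int[mu]_(x in `[(- n%:R)%R, (n%:R : R)%R]) (f x)%:E)%E.
  rewrite (@continuous_FTC2 _ f F)//.
  - exact: continuous_subspaceT.
  - split => //.
    + by apply: cvg_at_right_filter; exact: cF.
    + by apply: cvg_at_left_filter; exact: cF.
  - by move=> x _; rewrite derive1E; apply: derive_val; exact: dF.
rewrite integral_mkcond epatch_indic; apply: eq_integral => x _.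
by rewrite /f_ EFinM.
Unshelve. all: by end_near. Qed.

End IntegralOfDerivative.

(** * Moments of the normal density *)

Section NormalMoments.
Context (R : realType).
Notation mu := (@lebesgue_measure R).
Implicit Types (m s x : R).

Lemma le_exprn_fact_expR (y : R) k : 0 <= y -> y ^+ k <= k`!%:R * expR y.
Proof.
case: k => [|k] y0.
  by rewrite expr0 fact0 mul1r (le_trans _ (expR_ge1Dx y))// lerDl.
have k0 : 0 < k.+1`!%:R :> R by rewrite ltr0n fact_gt0.
rewrite mulrC -ler_pdivrMr// (le_trans _ (expR_ge1Dxn k y0))//.
by rewrite lerDr.
Qed.

(** Half of the exponent, (x - m)^2 / (4 s^2), absorbs the power; the other half is a bell curve of
    standard deviation [Num.sqrt 2 * s]. *)
Lemma normal_fun_exprn_le m s k : 0 < s -> exists2 C, 0 <= C &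
  forall x, (x - m) ^+ (2 * k) * normal_fun m s x <=
            C * normal_fun m (Num.sqrt 2 * s) x.
Proof.
move=> s0; exists (k`!%:R * (4 * s ^+ 2) ^+ k) => [|x].
  by rewrite mulr_ge0// exprn_ge0// mulr_ge0// sqr_ge0.
pose y := (x - m) ^+ 2 / (4 * s ^+ 2).
have s2 : 4 * s ^+ 2 != 0 by rewrite mulf_neq0// expf_neq0// gt_eqF.
have y0 : 0 <= y by rewrite divr_ge0// ?sqr_ge0// mulr_ge0// sqr_ge0.
have -> : (x - m) ^+ (2 * k) = (4 * s ^+ 2) ^+ k * y ^+ k.
  by rewrite exprM -exprMn /y mulrC divfK.
have -> : normal_fun m (Num.sqrt 2 * s) x = expR (- y).
  rewrite /normal_fun exprMn sqr_sqrtr// /y mulNr; congr (expR (- (_ / _))).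
  by rewrite -mulr_natl; ring.
have -> : normal_fun m s x = expR (- y) * expR (- y).
  rewrite -expRD /normal_fun /y; congr expR; field.
  by rewrite gt_eqF.
rewrite mulrA ler_wpM2r ?expR_ge0//.
rewrite -mulrA [leRHS]mulrC ler_wpM2l ?exprn_ge0 ?mulr_ge0 ?sqr_ge0 ?(ltW s0)//.
by rewrite expRN ler_pdivrMr ?expR_gt0// le_exprn_fact_expR.
Qed.


(** The inequality t <= 1 + t^2 at t = |x - m|^p reduces odd powers to even ones. The majorant
    combines two normal densities: it is integrable and bounded, whence integrability and decay at
    infinity. *)
Lemma normal_pdf_exprn_le m s p : 0 < s -> exists2 C, 0 <= C &
  forall x, `|(x - m) ^+ p * normal_pdf m s x| <=
            normal_pdf m s x + C * normal_pdf m (Num.sqrt 2 * s) x.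
Proof.
move=> s0; have [C C0 CP] := normal_fun_exprn_le m p s0.
have r0 : 0 < Num.sqrt 2 * s by rewrite mulr_gt0// sqrtr_gt0.
have q0 := normal_peak_gt0 (lt0r_neq0 r0).
exists (normal_peak s * C / normal_peak (Num.sqrt 2 * s)).
  by rewrite divr_ge0 ?mulr_ge0 ?normal_peak_ge0.
move=> x; rewrite normrM (ger0_norm (normal_pdf_ge0 _ _ _)) normrX.
apply: (@le_trans _ _ ((1 + (x - m) ^+ (2 * p)) * normal_pdf m s x)).
  rewrite ler_wpM2r ?normal_pdf_ge0// mulnC exprM -real_normK ?num_real// normrX.
  by set t := _ ^+ p; have : 0 <= t by [rewrite exprn_ge0]; nra.
rewrite mulrDl mul1r lerD2l !normal_pdfE ?gt_eqF// mulrCA.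
apply: (le_trans (ler_wpM2l (normal_peak_ge0 s) (CP x))).
by rewrite [leRHS]mulrA divfK ?gt_eqF// mulrA.
Qed.

Lemma integrable_exprn_normal_pdf m s p : 0 < s ->
  mu.-integrable setT (fun x => ((x - m) ^+ p * normal_pdf m s x)%:E).
Proof.
move=> s0; have [C C0 CP] := normal_pdf_exprn_le m p s0.
have gint : mu.-integrable setT (fun x =>
    ((normal_pdf m s x)%:E + C%:E * (normal_pdf m (Num.sqrt 2 * s) x)%:E)%E).
  apply: integrableD => //; first exact: integrable_normal_pdf.
  by apply: integrableZl => //; exact: integrable_normal_pdf.
apply: (le_integrable _ _ _ gint) => //.
- apply/measurable_EFinP; apply: measurable_funM; last exact: measurable_normal_pdf.
  by apply: measurable_funX; exact: measurable_funB.
- move=> x _ /=; rewrite lee_fin [leRHS]ger0_norm//.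
  by rewrite addr_ge0 ?mulr_ge0 ?normal_pdf_ge0.
Qed.

Lemma cvg_exprn_normal_pdf m s p (u : nat -> R) : 0 < s ->
  (fun n => `|u n|) @ \oo --> +oo ->
  (fun n => (u n - m) ^+ p * normal_pdf m s (u n)) @ \oo --> 0.
Proof.
move=> s0 uoo; have [C C0 CP] := normal_pdf_exprn_le m p.+1 s0.
pose B := normal_peak s + C * normal_peak (Num.sqrt 2 * s).
have r0 : Num.sqrt 2 * s != 0 by rewrite gt_eqF// mulr_gt0// sqrtr_gt0.
have B0 : 0 <= B by rewrite addr_ge0 ?mulr_ge0 ?normal_peak_ge0.
(* The power [p.+1] is still bounded, so the power [p] decays at least like 1 / |x - m|. *)
have bound x : `|(x - m) ^+ p * normal_pdf m s x| * `|x - m| <= B.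
  rewrite -normrM mulrAC -exprSr (le_trans (CP x))// lerD ?ler_wpM2l//.
  - by apply: normal_pdf_ub; rewrite gt_eqF.
  - exact: normal_pdf_ub.
apply/cvgr0Pnorm_le => e e0.
have uge : \forall n \near \oo, B / e + 1 + `|m| <= `|u n|.
  by move/cvgryPge: uoo; exact.
near=> n.
have : B / e + 1 + `|m| <= `|u n| by near: n; exact: uge.
rewrite -lerBrDr => /le_trans/(_ (lerB_dist _ _)) un.
have Be : 0 < B / e + 1 by rewrite ltr_wpDl// divr_ge0// ltW.
rewrite -(ler_pM2r Be).
have -> : e * (B / e + 1) = B + e by field; rewrite gt_eqF.
apply: (le_trans (ler_wpM2l (normr_ge0 _) un)).
by rewrite (le_trans (bound _))// lerDl ltW.
Unshelve. all: by end_near. Qed.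

(* The recursion is the integral over the line of the derivative of
   [(x - m)^(p+1)] times the density. *)
Lemma integral_exprn_normal_pdf m s p : 0 < s ->
  (\int[mu]_x ((x - m) ^+ 1 * normal_pdf m s x)%:E = 0)%E /\
  (\int[mu]_x ((x - m) ^+ p.+2 * normal_pdf m s x)%:E =
   (p.+1%:R * s ^+ 2)%:E * \int[mu]_x ((x - m) ^+ p * normal_pdf m s x)%:E)%E.
Proof.
move=> s0; have s20 : s ^+ 2 != 0 by rewrite expf_neq0// gt_eqF.
have dpdf x : is_derive x (1:R) (normal_pdf m s) (- (x - m) / s ^+ 2 * normal_pdf m s x).
  rewrite normal_pdfE ?gt_eqF// /normal_fun.
  apply: is_derive_eq; rewrite -![_ *: _]/(_ * _); field.
  by rewrite gt_eqF.
have cpdf : continuous (normal_pdf m s).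
  by apply: continuous_normal_pdf; rewrite gt_eqF.
have cX q : continuous (fun x : R => (x - m) ^+ q).
  move=> x; apply: (@continuous_comp _ _ _ (fun x => x - m) (fun x => x ^+ q)).
    by apply: cvgB; [exact: cvg_id|exact: cvg_cst].
  exact: exprn_continuous.
have abs_oo : (fun n : nat => `|n%:R : R|) @ \oo --> +oo.
  by under eq_fun do rewrite normr_nat; exact: cvgr_idn.
have abs_Noo : (fun n : nat => `|- n%:R : R|) @ \oo --> +oo.
  by under eq_fun do rewrite normrN.
(* With [a] and [r] left free, [q = 0] and [a = 0] give the vanishing first moment, and [q = p.+1]
   the recursion. *)
have ibp q (a : R) (r : nat) :
    (forall x, is_derive x (1:R) (fun x => (x - m) ^+ q) (a * (x - m) ^+ r)) ->
    (\int[mu]_x ((x - m) ^+ q.+1 * normal_pdf m s x)%:E =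
     (a * s ^+ 2)%:E * \int[mu]_x ((x - m) ^+ r * normal_pdf m s x)%:E)%E.
  move=> dX.
  pose f x := a * ((x - m) ^+ r * normal_pdf m s x) -
              (s ^+ 2)^-1 * ((x - m) ^+ q.+1 * normal_pdf m s x).
  have i1 := integrable_exprn_normal_pdf m r s0.
  have i2 := integrable_exprn_normal_pdf m q.+1 s0.
  have i1' := integrableZl measurableT a i1.
  have i2' := integrableZl measurableT (s ^+ 2)^-1 i2.
  have : (\int[mu]_x (f x)%:E = 0)%E.
    apply: (@integral_derive_eq0 _ (fun x => (x - m) ^+ q * normal_pdf m s x)).
    - move=> x; apply: is_derive_eq.
      rewrite -![_ *: _]/(_ * _) /f (exprS (x - m) q); field.
      by rewrite gt_eqF.
    - move=> x; apply: cvgB; apply: cvgM; try exact: cvg_cst; apply: cvgM;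
        by [exact: cX|exact: cpdf].
    - by apply: eq_integrable (integrableB measurableT i1' i2').
    - exact: cvg_exprn_normal_pdf.
    - exact: cvg_exprn_normal_pdf.
  rewrite /f; under eq_integral do rewrite EFinB (EFinM a) (EFinM (s ^+ 2)^-1).
  rewrite integralB// integralZl// integralZl//.
  have := integrable_fin_num measurableT i1.
  have := integrable_fin_num measurableT i2.
  move=> /fineK <- /fineK <-; rewrite -!EFinM -EFinB => -[] /eqP.
  rewrite subr_eq0 => /eqP E; congr EFin.
  by rewrite -mulrA mulrCA E mulVKf.
split; last first.
  apply: ibp => x.
  have -> : (fun x : R => (x - m) ^+ p.+1) = (fun x => x - m) ^+ p.+1.
    by apply/funext => y; rewrite exprfctE.
  by apply: is_derive_eq; rewrite -![_ *: _]/(_ * _) subr0 mulr1.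
transitivity ((0 * s ^+ 2)%:E *
    \int[mu]_x ((x - m) ^+ 0 * normal_pdf m s x)%:E)%E; last by rewrite mul0r mul0e.
apply: ibp => x; rewrite mul0r; exact: is_derive_cst.
Qed.

End NormalMoments.

Section RealGaussianMoments.
Context d (T : measurableType d) (R : realType) (P : probability T R).

Lemma integral_law (X : T -> R)
    (nu : {measure set (measurableTypeR R) -> \bar R}) (f : R -> R) :
  measurable_fun setT X ->
  (forall B, measurable B -> P (X @^-1` B) = nu B) ->
  measurable_fun setT f ->
  (nu.-integrable setT (EFin \o f) <-> P.-integrable setT (EFin \o f \o X)) /\
  (\int[nu]_x (f x)%:E = \int[P]_w (f (X w))%:E)%E.
Proof.
move=> mX law mf.
have m1 : measurable_fun setT (fun _ : T => 1 : R) by exact: measurable_cst.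
have w0 (x : T) : 0 <= 1 :> R by [].
have nuE B : measurable B -> (nu B = \int[P]_(x in X @^-1` B) 1%:E)%E.
  move=> mB; have mXB : measurable (X @^-1` B).
    by rewrite -[X in measurable X]setTI; exact: mX.
  by rewrite integral_cst// mul1e; exact/esym/law.
have := @integrable_reweight _ _ T (measurableTypeR R) R P nu X _ mX m1 w0 nuE f mf.
have := @integral_reweight _ _ T (measurableTypeR R) R P nu X _ mX m1 w0 nuE f mf.
rewrite (_ : (fun x => (1 * f (X x))%:E) = EFin \o f \o X); last first.
  by apply/funext => w; rewrite mul1r.
by [].
Qed.

Lemma integral_normal_prob (m s : R) (f : R -> R) : 0 < s ->
  measurable_fun setT f ->
  ((normal_prob m s).-integrable setT (EFin \o f) <->
   (@lebesgue_measure R).-integrable setT (fun x => (f x * normal_pdf m s x)%:E)) /\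
  (\int[normal_prob m s]_x (f x)%:E =
   \int[@lebesgue_measure R]_x (f x * normal_pdf m s x)%:E)%E.
Proof.
move=> s0 mf.
have mpdf := measurable_normal_pdf m s.
have nuE B : measurable B -> (normal_prob m s B =
    \int[@lebesgue_measure R]_(x in idfun @^-1` B) (normal_pdf m s x)%:E)%E.
  by [].
have mid : @measurable_fun _ _ (measurableTypeR R) (measurableTypeR R) setT idfun.
  exact: measurable_id.
have := @integrable_reweight _ _ (measurableTypeR R) (measurableTypeR R) R
  lebesgue_measure (normal_prob m s) idfun _ mid mpdf (normal_pdf_ge0 m s) nuE f mf.
have := @integral_reweight _ _ (measurableTypeR R) (measurableTypeR R) R
  lebesgue_measure (normal_prob m s) idfun _ mid mpdf (normal_pdf_ge0 m s) nuE f mf.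
rewrite (_ : (fun x => (normal_pdf m s x * f (idfun x))%:E) =
             (fun x => (f x * normal_pdf m s x)%:E)); last first.
  by apply/funext => x; rewrite mulrC.
by [].
Qed.

(** One recursion covers both alternatives of [real_gaussian]: the variance [v] is [s ^+ 2] for a
    normal law and 0 for a Dirac mass, which a zero mean puts at the origin. *)
Lemma real_gaussian_moments (X : T -> R) : real_gaussian P X ->
  \int[P]_w X w = 0 -> exists v : R, forall p,
  P.-integrable setT (EFin \o (fun w => X w ^+ p)) /\
  \int[P]_w X w ^+ p.+2 = p.+1%:R * v * \int[P]_w X w ^+ p.
Proof.
move=> [mX [[m [s [s0 law]]]|[m law]]] EX0.
- have mf p : measurable_fun setT (fun x : R => (x - m) ^+ p).
    by apply: measurable_funX; exact: measurable_funB.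
  have int p : P.-integrable setT (EFin \o (fun w => (X w - m) ^+ p)).
    have [[+ _] _] := integral_law (nu := normal_prob m s) mX law (mf p); apply.
    have [[_ +] _] := integral_normal_prob m s0 (mf p); apply.
    exact: integrable_exprn_normal_pdf.
  have intE p : (\int[P]_w ((X w - m) ^+ p)%:E =
      \int[@lebesgue_measure R]_x ((x - m) ^+ p * normal_pdf m s x)%:E)%E.
    rewrite -(integral_law (nu := normal_prob m s) mX law (mf p)).2.
    exact: (integral_normal_prob m s0 (mf p)).2.
  have m0 : m = 0.
    have [+ _] := integral_exprn_normal_pdf m 0%N s0.
    rewrite -intE; under eq_integral do rewrite expr1.
    have Xm : \int[P]_w X w = \int[P]_w ((X w - m) + m).
      by apply: eq_Rintegral => w _; rewrite subrK.
    move: Xm; rewrite EX0 RintegralD//.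
      have -> : \int[P]__ m = m.
        by rewrite Rintegral_cst// [fine _](congr1 fine (probability_setT P)) mulr1.
      by rewrite /Rintegral => -> B; rewrite B add0r.
      by have := int 1%N.
    exact: finite_measure_integrable_cst.
  exists (s ^+ 2) => p; rewrite m0 in int intE.
  split; first by have := int p; under eq_fun do rewrite subr0.
  have [_] := integral_exprn_normal_pdf m p s0.
  rewrite m0 -!intE; under eq_integral do rewrite subr0.
  under [X in _ = (_ * X)%E]eq_integral do rewrite subr0.
  rewrite /Rintegral => ->; have := int p; under eq_fun do rewrite subr0.
  by move=> /(integrable_fin_num measurableT)/fineK <-.
- pose nu := @dirac _ (measurableTypeR R) m R.
  have mf p : measurable_fun setT (fun x : R => x ^+ p).
    exact: measurable_funX.
  have int p : P.-integrable setT (EFin \o (fun w => X w ^+ p)).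
    have [[+ _] _] := integral_law (nu := nu) mX law (mf p); apply.
    apply/integrableP; split; first exact/measurable_EFinP.
    rewrite integral_dirac//= ?diracT ?mul1e ?ltry//.
    by apply/measurable_EFinP; apply: measurableT_comp => //; exact: (mf p).
  have intE p : \int[P]_w (X w ^+ p) = m ^+ p.
    rewrite /Rintegral -(integral_law (nu := nu) mX law (mf p)).2 integral_dirac//=.
      by rewrite indicE in_setT mul1r.
    exact/measurable_EFinP.
  have m0 : m = 0.
    by rewrite -[m]expr1 -intE -[RHS]EX0; apply: eq_Rintegral.
  by exists 0 => p; split => //; rewrite !intE m0 expr0n/= mulr0 mul0r.
Qed.

End RealGaussianMoments.

Lemma poly_eq_nat (F : numFieldType) (p q : {poly F}) :
  (forall n : nat, p.[n%:R] = q.[n%:R]) -> p = q.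
Proof.
move=> pq; apply/eqP; rewrite -subr_eq0; apply: contraT => pq0.
have := @max_poly_roots _ _ [seq (n%:R : F) | n <- iota 0 (size (p - q))] pq0.
rewrite size_map size_iota ltnn => -> //.
- by apply/allP => _ /mapP[n _ ->]; rewrite rootE !hornerE pq subrr.
- by rewrite map_inj_uniq ?iota_uniq//; exact: (mulrIn (oner_neq0 F)).
Qed.

(** The double factorial (2h - 1)!!, the moment of order 2h of the standard normal law. *)
Definition odd_prod (h : nat) : nat := (\prod_(i < h) (2 * i).+1)%N.

Lemma fact_double (h : nat) : ((2 * h)`! = 2 ^ h * h`! * odd_prod h)%N.
Proof.
elim: h => [|h IH]; first by rewrite /odd_prod big_ord0.
rewrite /odd_prod big_ord_recr/= -/(odd_prod h) mulnS !addSn add0n 2!factS IH.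
by rewrite factS expnS; lia.
Qed.

(** Converts the double factorial of real Gaussian moments into the factorial of complex ones. *)
Lemma bin_double_odd_prod (h : nat) : ('C(2 * h, h) * h`! = 2 ^ h * odd_prod h)%N.
Proof.
have := @bin_fact (2 * h) h; rewrite fact_double.
have -> : (2 * h - h = h)%N by lia.
move=> /(_ _)/eqP; rewrite (_ : (h <= 2 * h)%N); last by lia.
move=> /(_ isT); rewrite mulnA [X in _ == X]mulnAC eqn_pmul2r ?fact_gt0//.
by move/eqP.
Qed.

Section CenteredGaussian.
Context d (T : measurableType d) (R : realType) (P : probability T R).
Variable X : T -> R.
Hypothesis gX : real_gaussian P X.
Hypothesis EX0 : \int[P]_w X w = 0.

Lemma integrable_gaussian_exprn p : P.-integrable setT (EFin \o (fun w => X w ^+ p)).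
Proof. by have [v /(_ p)[]] := real_gaussian_moments gX EX0. Qed.

Lemma gaussian_even_moment h :
  \int[P]_w X w ^+ (2 * h) = (odd_prod h)%:R * (\int[P]_w X w ^+ 2) ^+ h.
Proof.
have [v mom] := real_gaussian_moments gX EX0.
have E0 : \int[P]_w X w ^+ 0 = 1.
  under eq_Rintegral do rewrite expr0.
  by rewrite Rintegral_cst// [fine _](congr1 fine (probability_setT P)) mulr1.
have -> : \int[P]_w X w ^+ 2 = v by rewrite (mom 0%N).2 E0 mulr1 mul1r.
elim: h => [|h IH]; first by rewrite muln0 E0 /odd_prod big_ord0 expr0 mulr1.
rewrite mulnS !addSn add0n (mom _).2 IH /odd_prod big_ord_recr/= natrM exprS.
by ring.
Qed.

Lemma gaussian_odd_moment h : \int[P]_w X w ^+ (2 * h).+1 = 0.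
Proof.
have [v mom] := real_gaussian_moments gX EX0.
elim: h => [|h IH]; first by rewrite muln0; under eq_Rintegral do rewrite expr1.
by rewrite mulnS !addSn add0n (mom _).2 IH mulr0.
Qed.

End CenteredGaussian.

Lemma Rintegral_sum d (T : measurableType d) (R : realType) (P : probability T R)
    I (s : seq I) (F : I -> T -> R) :
  (forall i, P.-integrable setT (EFin \o F i)) ->
  \int[P]_w (\sum_(i <- s) F i w) = \sum_(i <- s) \int[P]_w F i w.
Proof.
move=> Fi; rewrite -[LHS]/(complex.Re (Complex _ (\int[P]_w 0))).
have cF i : cintegrable P (fun w => (F i w)%:C%C).
  by split; [exact: Fi|exact: finite_measure_integrable_cst].
have := cexpectation_sum s cF.
rewrite (_ : (fun w => _) = (fun w => (\sum_(i <- s) F i w)%:C%C)); last first.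
  by apply/funext => w; rewrite rmorph_sum.
rewrite cexpectationE/= => /(congr1 (@complex.Re R))/= ->.
rewrite -[RHS]/(complex.Re (\sum_(i <- s) \int[P]_w F i w)%:C%C) rmorph_sum.
congr complex.Re; apply: eq_bigr => i _.
by rewrite cexpectationE/= Rintegral_cst// mul0r.
Qed.

(** * Moments of complex Gaussian variables *)

Section ComplexGaussian.
Context d (T : measurableType d) (R : realType) (P : probability T R).
Variables (g : T -> R[i]) (v : R).
Hypothesis gg : complex_gaussian P g.
Hypothesis Eg : cexpectation P g = 0.
Hypothesis Eg2 : cexpectation P (fun w => g w ^+ 2) = 0.
Hypothesis Egg : cexpectation P (fun w => `|g w| ^+ 2) = v%:C%C.

Let X w := complex.Re (g w).
Let Y w := complex.Im (g w).

Let gX : real_gaussian P X.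
Proof.
by have := gg 1 0; under eq_fun do rewrite mul1r mul0r addr0.
Qed.

Let gY : real_gaussian P Y.
Proof.
by have := gg 0 1; under eq_fun do rewrite mul1r mul0r add0r.
Qed.

Let EX : \int[P]_w X w = 0.
Proof. by move: Eg; rewrite cexpectationE => -[]. Qed.

Let EY : \int[P]_w Y w = 0.
Proof. by move: Eg; rewrite cexpectationE => -[]. Qed.

(** Independence of [X] and [Y] is not among the assumptions, so the product is dominated by X^(2j)
    + Y^(2k). *)
Let iXY j k : P.-integrable setT (EFin \o (fun w => X w ^+ j * Y w ^+ k)).
Proof.
have iX := integrable_gaussian_exprn gX EX (2 * j).
have iY := integrable_gaussian_exprn gY EY (2 * k).
apply: (le_integrable _ _ _ (integrable_EFinD iX iY)) => //.
  apply/measurable_EFinP; apply: measurable_funM.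
    by apply: measurable_funX; have [] := gX.
  by apply: measurable_funX; have [] := gY.
move=> w _ /=; rewrite lee_fin !(mulnC 2%N) !exprM normrM.
rewrite [leRHS]ger0_norm ?addr_ge0 ?sqr_ge0//.
rewrite -[leRHS]/(_ + _) -(real_normK (num_real (X w ^+ j))).
rewrite -(real_normK (num_real (Y w ^+ k))).
by set a := `|X w ^+ j|; set b := `|Y w ^+ k|; nra.
Qed.

Let e j k := \int[P]_w (X w ^+ j * Y w ^+ k).

Let Egre : e 2 0 = e 0 2 /\ e 1 1 = 0.
Proof.
have i20 := iXY 2 0; have i02 := iXY 0 2; have i11 := iXY 1 1.
move: Eg2; rewrite cexpectationE => -[].
have -> : \int[P]_w complex.Re (g w ^+ 2) =
    \int[P]_w (X w ^+ 2 * Y w ^+ 0 - X w ^+ 0 * Y w ^+ 2).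
  by apply: eq_Rintegral => w _; rewrite /X /Y; case: (g w) => x y /=; ring.
have -> : \int[P]_w complex.Im (g w ^+ 2) =
    \int[P]_w (2 * (X w ^+ 1 * Y w ^+ 1)).
  by apply: eq_Rintegral => w _; rewrite /X /Y; case: (g w) => x y /=; ring.
rewrite RintegralB// RintegralZl// => /eqP; rewrite subr_eq0 => /eqP E1 /eqP.
by rewrite mulf_eq0 pnatr_eq0/= => /eqP.
Qed.

Let e20 : e 2 0 = v / 2.
Proof.
have i20 := iXY 2 0; have i02 := iXY 0 2.
move: Egg; rewrite cexpectationE => -[+ _].
have -> : \int[P]_w complex.Re (`|g w| ^+ 2) =
    \int[P]_w (X w ^+ 2 * Y w ^+ 0 + X w ^+ 0 * Y w ^+ 2).
  apply: eq_Rintegral => w _; rewrite !expr0 mulr1 mul1r /X /Y.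
  case: (g w) => a b; rewrite normc_def -rmorphXn/= sqr_sqrtr//.
  by rewrite addr_ge0 ?sqr_ge0.
rewrite RintegralD// -/(e 2 0) -/(e 0 2) -Egre.1 => <-.
by field.
Qed.

Let Elin2 (a b : R) :
  \int[P]_w (a * X w + b * Y w) ^+ 2 = (a ^+ 2 + b ^+ 2) * (v / 2).
Proof.
have i20 := iXY 2 0; have i02 := iXY 0 2; have i11 := iXY 1 1.
have -> : \int[P]_w (a * X w + b * Y w) ^+ 2 =
   \int[P]_w (a ^+ 2 * (X w ^+ 2 * Y w ^+ 0) + (2 * a * b * (X w ^+ 1 * Y w ^+ 1)
      + b ^+ 2 * (X w ^+ 0 * Y w ^+ 2))).
  by apply: eq_Rintegral => w _; rewrite !expr0 !expr1; ring.
have j1 := integrable_EFinZ (a ^+ 2) i20.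
have j2 := integrable_EFinZ (2 * a * b) i11.
have j3 := integrable_EFinZ (b ^+ 2) i02.
rewrite (RintegralD measurableT j1 (integrable_EFinD j2 j3)).
rewrite (RintegralD measurableT j2 j3) (RintegralZl _ measurableT i20).
rewrite (RintegralZl _ measurableT i11) (RintegralZl _ measurableT i02).
have E20 : \int[P]_w (X w ^+ 2 * Y w ^+ 0) = v / 2 by exact: e20.
have E02 : \int[P]_w (X w ^+ 0 * Y w ^+ 2) = v / 2 by rewrite -e20 Egre.1.
have E11 : \int[P]_w (X w ^+ 1 * Y w ^+ 1) = 0 by exact: Egre.2.
by rewrite E20 E02 E11; ring.
Qed.


(** The left side expands the moment of order m of [a * X + b * Y], a centred Gaussian whose
    variance is (a^2 + b^2) v / 2 by [Elin2]. *)
Let Elin (a b : R) m : \sum_(j < m.+1) 'C(m, j)%:R * a ^+ (m - j) * b ^+ j * e (m - j) j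
  = if odd m then 0 else (odd_prod m./2)%:R * (v / 2) ^+ m./2 * (a ^+ 2 + b ^+ 2) ^+ m./2.
Proof.
pose S w := a * X w + b * Y w.
have gS : real_gaussian P S by exact: gg.
have iX : P.-integrable setT (EFin \o X).
  by have := integrable_gaussian_exprn gX EX 1.
have iY : P.-integrable setT (EFin \o Y).
  by have := integrable_gaussian_exprn gY EY 1.
have ES : \int[P]_w S w = 0.
  rewrite (RintegralD measurableT (integrable_EFinZ a iX) (integrable_EFinZ b iY)).
  rewrite (RintegralZl _ measurableT iX) (RintegralZl _ measurableT iY).
  by rewrite EX EY !mulr0 addr0.
transitivity (\int[P]_w S w ^+ m); last first.
  case: ifPn => om; rewrite -[in LHS](odd_double_half m).
    by rewrite om add1n -mul2n gaussian_odd_moment.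
  by rewrite (negbTE om) add0n -mul2n gaussian_even_moment// Elin2 exprMn; ring.
pose F (j : 'I_m.+1) w :=
  'C(m, j)%:R * a ^+ (m - j) * b ^+ j * (X w ^+ (m - j) * Y w ^+ j).
transitivity (\int[P]_w \sum_(j < m.+1) F j w).
  rewrite Rintegral_sum; last by move=> j; apply: integrable_EFinZ; exact: iXY.
  by apply: eq_bigr => j _; rewrite (RintegralZl _ measurableT (iXY _ _)).
apply: eq_Rintegral => w _; rewrite exprDn; apply: eq_bigr => j _.
by rewrite /F -mulr_natl !exprMn; ring.
Qed.

Let ceXY j k : cintegrable P (fun w => (X w ^+ j * Y w ^+ k)%:C%C) /\
  cexpectation P (fun w => (X w ^+ j * Y w ^+ k)%:C%C) = (e j k)%:C%C.
Proof.
split; last by rewrite cexpectationE/= Rintegral_cst// mul0r.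
by split; [exact: iXY|exact: finite_measure_integrable_cst].
Qed.

(* A polynomial identity in [a] and [b] that holds for real numbers holds for
   complex ones. *)
Let Elinc (a b : R[i]) m :
  \sum_(j < m.+1) 'C(m, j)%:R * a ^+ (m - j) * b ^+ j * (e (m - j) j)%:C%C
  = if odd m then 0 else
    (odd_prod m./2)%:R * (v%:C%C / 2) ^+ m./2 * (a ^+ 2 + b ^+ 2) ^+ m./2.
Proof.
pose c : R[i] := if odd m then 0 else (odd_prod m./2)%:R * (v%:C%C / 2) ^+ m./2.
suff : \sum_(j < m.+1) 'C(m, j)%:R * a ^+ (m - j) * b ^+ j * (e (m - j) j)%:C%C
    = c * (a ^+ 2 + b ^+ 2) ^+ m./2.
  by move=> ->; rewrite /c; case: ifP => // _; rewrite mul0r.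
have Enat (x y : nat) : \sum_(j < m.+1)
    'C(m, j)%:R * x%:R ^+ (m - j) * y%:R ^+ j * (e (m - j) j)%:C%C
    = c * (x%:R ^+ 2 + y%:R ^+ 2) ^+ m./2 :> R[i].
  have /(congr1 (fun z : R => z%:C%C)) := Elin x%:R y%:R m.
  rewrite rmorph_sum/= => E.
  transitivity (\sum_(i < m.+1)
    ('C(m, i)%:R * x%:R ^+ (m - i) * y%:R ^+ i * e (m - i) i)%:C%C).
    by apply: eq_bigr => j _; rewrite !rmorphM/= !rmorphXn/= !rmorph_nat.
  rewrite E /c; case: ifP => _; rewrite ?mul0r// !rmorphM/= !rmorphXn/=.
  by rewrite rmorphD/= !rmorphXn/= fmorph_div/= !rmorph_nat.
have Eb (x : R[i]) (y : nat) : \sum_(j < m.+1)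
    'C(m, j)%:R * x ^+ (m - j) * y%:R ^+ j * (e (m - j) j)%:C%C
    = c * (x ^+ 2 + y%:R ^+ 2) ^+ m./2 :> R[i].
  pose p : {poly R[i]} := \sum_(j < m.+1)
    ('C(m, j)%:R * y%:R ^+ j * (e (m - j) j)%:C%C)%:P * 'X^(m - j).
  pose q : {poly R[i]} := c%:P * ('X^2 + (y%:R ^+ 2)%:P) ^+ m./2.
  have pE z : p.[z] = \sum_(j < m.+1)
      'C(m, j)%:R * z ^+ (m - j) * y%:R ^+ j * (e (m - j) j)%:C%C.
    by rewrite horner_sum; apply: eq_bigr => j _; rewrite !hornerE; ring.
  have qE z : q.[z] = c * (z ^+ 2 + y%:R ^+ 2) ^+ m./2 by rewrite !hornerE.
  by rewrite -pE -qE; congr (_.[_]); apply: poly_eq_nat => n; rewrite pE qE.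
pose p : {poly R[i]} := \sum_(j < m.+1)
  ('C(m, j)%:R * a ^+ (m - j) * (e (m - j) j)%:C%C)%:P * 'X^j.
pose q : {poly R[i]} := c%:P * ((a ^+ 2)%:P + 'X^2) ^+ m./2.
have pE z : p.[z] = \sum_(j < m.+1)
    'C(m, j)%:R * a ^+ (m - j) * z ^+ j * (e (m - j) j)%:C%C.
  by rewrite horner_sum; apply: eq_bigr => j _; rewrite !hornerE; ring.
have qE z : q.[z] = c * (a ^+ 2 + z ^+ 2) ^+ m./2 by rewrite !hornerE.
by rewrite -pE -qE; congr (_.[_]); apply: poly_eq_nat => n; rewrite pE qE.
Qed.


Let gE w : g w = (X w)%:C%C + 'i%C * (Y w)%:C%C.
Proof. by rewrite {1}[g w]complexE. Qed.

Let gcE w : (g w)^* = (X w)%:C%C - 'i%C * (Y w)%:C%C.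
Proof.
rewrite /X /Y; case: (g w) => a b; apply/eqP; rewrite eq_complex/=.
by rewrite !(mul0r, mulr0, mul1r, subr0, sub0r, oppr0, addr0, add0r) !eqxx.
Qed.

(** The extra factor X^j Y^k carries the induction: each [g] or conjugate is expanded in [X] and [Y]
    and moved into it. *)
Let igXY p q j k :
  cintegrable P (fun w => g w ^+ p * (g w)^* ^+ q * (X w ^+ j * Y w ^+ k)%:C%C).
Proof.
elim: p q j k => [|p IHp] q j k.
  elim: q j k => [|q IHq] j k.
    by under eq_fun do rewrite !expr0 !mul1r; exact: (ceXY j k).1.
  rewrite (_ : (fun w => _) = (fun w =>
      1 * (g w ^+ 0 * (g w)^* ^+ q * (X w ^+ j.+1 * Y w ^+ k)%:C%C) +
      - 'i%C * (g w ^+ 0 * (g w)^* ^+ q * (X w ^+ j * Y w ^+ k.+1)%:C%C))).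
    by apply: cintegrableD; apply: cintegrableZ; exact: IHq.
  by apply/funext => w; rewrite exprS gcE (exprS (X w)) (exprS (Y w)) !rmorphM/=; ring.
rewrite (_ : (fun w => _) = (fun w =>
    1 * (g w ^+ p * (g w)^* ^+ q * (X w ^+ j.+1 * Y w ^+ k)%:C%C) +
    'i%C * (g w ^+ p * (g w)^* ^+ q * (X w ^+ j * Y w ^+ k.+1)%:C%C))).
  by apply: cintegrableD; apply: cintegrableZ; exact: IHp.
apply/funext => w; rewrite exprS {1}gE (exprS (X w)) (exprS (Y w)) !rmorphM/=; ring.
Qed.

Lemma cintegrable_complex_gaussian p q : cintegrable P (fun w => g w ^+ p * (g w)^* ^+ q).
Proof.
by have := igXY p q 0 0; under eq_fun do rewrite !expr0 !mulr1.
Qed.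

(** The combination a g + conj(g) equals (a + 1) X + i (a - 1) Y, and the squares of these two
    coefficients add up to 4a. By [Elinc] its moment of order m = p + q is a constant times a^(m/2),
    or 0 for odd m; the coefficient of a^p in the binomial expansion is the moment sought, up to a
    binomial coefficient. *)
Lemma complex_gaussian_moment p q : cexpectation P (fun w => g w ^+ p * (g w)^* ^+ q) =
  if p == q then p`!%:R * v%:C%C ^+ p else 0.
Proof.
pose E p q := cexpectation P (fun w => g w ^+ p * (g w)^* ^+ q).
rewrite -/(E p q); pose m := (p + q)%N.
pose c : R[i] := if odd m then 0 else
  (odd_prod m./2)%:R * (v%:C%C / 2) ^+ m./2 * 4 ^+ m./2.
have Ea (a : R[i]) : \sum_(j < m.+1) 'C(m, j)%:R * a ^+ (m - j) * E (m - j)%N j =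
    c * a ^+ m./2.
  have := Elinc (a + 1) ('i%C * (a - 1)) m.
  have -> : (a + 1) ^+ 2 + ('i%C * (a - 1)) ^+ 2 = 4 * a.
    rewrite [('i%C * _) ^+ 2]exprMn sqr_i; ring.
  rewrite (exprMn m./2 4 a) => E1.
  have -> : c * a ^+ m./2 = cexpectation P (fun w => \sum_(j < m.+1)
      ('C(m, j)%:R * (a + 1) ^+ (m - j) * ('i%C * (a - 1)) ^+ j) *
      (X w ^+ (m - j) * Y w ^+ j)%:C%C).
    rewrite cexpectation_sum; last by move=> j; apply: cintegrableZ; exact: (ceXY _ _).1.
    transitivity (\sum_(j < m.+1) 'C(m, j)%:R * (a + 1) ^+ (m - j) *
        ('i%C * (a - 1)) ^+ j * (e (m - j) j)%:C%C).
      by rewrite E1 /c; case: ifP => _; rewrite ?mul0r// !mulrA.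
    by apply: eq_bigr => j _; rewrite cexpectationZ ?(ceXY _ _).2//; exact: (ceXY _ _).1.
  transitivity (cexpectation P (fun w => \sum_(j < m.+1)
      ('C(m, j)%:R * a ^+ (m - j)) * (g w ^+ (m - j) * (g w)^* ^+ j))).
    rewrite cexpectation_sum; last first.
      by move=> j; apply: cintegrableZ; exact: cintegrable_complex_gaussian.
    apply: eq_bigr => j _; rewrite cexpectationZ//.
    exact: cintegrable_complex_gaussian.
  congr (cexpectation P _); apply/funext => w.
  transitivity ((a * g w + (g w)^*) ^+ m).
    by rewrite exprDn; apply: eq_bigr => j _; rewrite -mulr_natl exprMn; ring.
  have -> : a * g w + (g w)^* = (a + 1) * (X w)%:C%C + ('i%C * (a - 1)) * (Y w)%:C%C.
    by rewrite {1}gE gcE; ring.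
  rewrite exprDn; apply: eq_bigr => j _.
  by rewrite -mulr_natl !exprMn rmorphM/= !rmorphXn/=; ring.
have Ep : \sum_(j < m.+1) ('C(m, j)%:R * E (m - j)%N j)%:P * 'X^(m - j) =
    c%:P * 'X^(m./2).
  apply: poly_eq_nat => n; rewrite horner_sum !hornerE -Ea.
  by apply: eq_bigr => j _; rewrite !hornerE; ring.
have {Ep} := congr1 (fun r : {poly R[i]} => r`_p) Ep.
rewrite coef_sum coefCM coefXn.
have qm : (q < m.+1)%N by rewrite ltnS leq_addl.
rewrite (bigD1 (Ordinal qm))//= big1 => [|j jq]; last first.
  rewrite coefCM coefXn; case: eqP => [pj|]; last by rewrite mulr0.
  case/eqP: jq; apply/val_inj => /=; have := ltn_ord j; rewrite /m in pj *; lia.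
have mq : (m - q = p)%N by rewrite /m addnK.
rewrite mq coefCM coefXn eqxx mulr1 addr0 => Epq.
have C0 : 'C(m, q)%:R != 0 :> R[i] by rewrite pnatr_eq0 -lt0n bin_gt0 -ltnS.
apply: (mulfI C0); rewrite Epq; case: (p =P q) => [pq|/eqP pq].
  have m2p : m = (2 * p)%N by rewrite /m -pq addnn mul2n.
  rewrite -pq m2p mul2n doubleK eqxx mulr1 /c m2p mul2n odd_double doubleK.
  rewrite -mul2n [RHS]mulrA -natrM bin_double_odd_prod natrM natrX.
  rewrite -[RHS]mulrA [RHS]mulrC -!mulrA -!exprMn; congr (_ * (_ ^+ _)).
  by field.
rewrite mulr0 /c; case: ifP => [_|om]; first by rewrite mul0r.
case: eqP => [pm|]; last by rewrite mulr0.
case/eqP: pq; have := odd_double_half m; rewrite om -pm add0n /m; lia.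
Qed.

End ComplexGaussian.

(** * Sums over pairings *)

Section Picks.
Variable T : Type.
Implicit Types (s : seq T).

(** Positions are enumerated rather than values: equal letters are distinct partners, as Wick's
    formula requires. *)
Fixpoint picks s : seq (T * seq T) :=
  if s is x :: s' then (x, s') :: [seq (p.1, x :: p.2) | p <- picks s'] else [::].

Lemma picks_cat s1 s2 : picks (s1 ++ s2) =
  [seq (p.1, p.2 ++ s2) | p <- picks s1] ++ [seq (p.1, s1 ++ p.2) | p <- picks s2].
Proof.
elim: s1 => [|x s1 IH] /=; first by rewrite -[LHS]map_id; apply: eq_map => -[].
by rewrite IH map_cat -!map_comp.
Qed.

Lemma size_picks s : size (picks s) = size s.
Proof. by elim: s => //= x s IH; rewrite size_map IH. Qed.

End Picks.

Lemma perm_picks (T : eqType) (s : seq T) p : p \in picks s -> perm_eq (p.1 :: p.2) s.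
Proof.
elim: s p => //= x s IH p; rewrite inE => /predU1P[->//|/mapP[q /IH qs ->]] /=.
by rewrite -[q.1 :: _]/([:: q.1] ++ [:: x] ++ q.2) perm_catCA/= perm_cons.
Qed.

Lemma size_pick (T : eqType) (s : seq T) p : p \in picks s -> size p.2 = (size s).-1.
Proof. by move=> /perm_picks/perm_size <-. Qed.

Section WickSum.
Variables (F : numFieldType) (E : eqType) (cov : E -> E -> F).

(* The stack contains the letters already read that are still to be paired. *)
Fixpoint wick (st l : seq E) : F :=
  if l is x :: l' then
    wick (x :: st) l' + \sum_(p <- picks st) cov p.1 x * wick p.2 l'
  else (nilp st)%:R.

(** A letter on the stack, whatever its depth, is closed by one of the letters still to come.
    Choosing that letter at once links the stack recursion to the usual one, which pairs the first
    letter of the word. *)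
Lemma wick_pick x s1 s2 l :
  wick (s1 ++ x :: s2) l = \sum_(p <- picks l) cov x p.1 * wick (s1 ++ s2) p.2.
Proof.
elim: l s1 s2 => [|y l IH] s1 s2.
  by rewrite /= big_nil; case: s1.
rewrite [LHS]/= [picks (y :: l)]/= big_cons big_map/=.
rewrite -cat_cons IH cat_cons picks_cat big_cat big_map/= big_cons big_map/=.
(* Exchanges the choice of the partner of [x] with that of the letter closed by [y]. *)
have swap (I : Type) (r : seq I) (a : I -> F) (st st' : I -> seq E) :
    (forall i, wick (st i) l = \sum_(q <- picks l) cov x q.1 * wick (st' i) q.2) ->
    \sum_(i <- r) a i * wick (st i) l =
    \sum_(q <- picks l) cov x q.1 * \sum_(i <- r) a i * wick (st' i) q.2.
  move=> stE; under eq_bigr do rewrite stE mulr_sumr.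
  rewrite exchange_big; apply: eq_bigr => q _; rewrite mulr_sumr.
  by apply: eq_bigr => i _; rewrite mulrCA.
rewrite (swap _ _ _ _ (fun p => p.2 ++ s2))//.
rewrite big_map/= (swap _ (picks s2) _ _ (fun p => s1 ++ p.2))//.
rewrite [in RHS](eq_bigr (fun q => cov x q.1 * wick (y :: s1 ++ s2) q.2 +
    (cov x q.1 * \sum_(p <- picks s1) cov p.1 y * wick (p.2 ++ s2) q.2 +
     cov x q.1 * \sum_(p <- picks s2) cov p.1 y * wick (s1 ++ p.2) q.2))); last first.
  by move=> q _; rewrite picks_cat big_cat !big_map/= -!mulrDr.
rewrite !big_split/=; ring.
Qed.

Lemma wickE (f : seq E -> F) : f [::] = 1 ->
  (forall x l, f (x :: l) = \sum_(p <- picks l) cov x p.1 * f p.2) ->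
  forall l, f l = wick [::] l.
Proof.
move=> f0 fS l; have [n] := ubnP (size l); elim: n => // n IH in l *.
case: l => [|x l]/=; first by rewrite f0.
rewrite ltnS big_nil addr0 => ln; rewrite -[[:: x]]cat0s wick_pick fS.
rewrite big_seq [RHS]big_seq; apply: eq_bigr => p /size_pick pl.
by rewrite IH// pl (leq_ltn_trans (leq_pred _)).
Qed.

End WickSum.

(** The identity stands for the unpermuted matrix, so that the three matrices are treated
    uniformly. *)
Definition entry_perm N (k : 'I_3) : {perm 'I_(N * N) * 'I_(N * N)} :=
  tnth [tuple 1%g; partial_transpose N; mixing_map N] k.

(* Only pairings that always match the top of the stack with an equal letter
   other than the mixed one survive in the limit. *)
Definition good_pair (k0 k : 'I_3) : bool := (k0 == k) && (k != ord_max).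

(** The recursion of [wick] with good closings of the top letter only, each of weight 1. *)
Fixpoint fock_count (u l : seq 'I_3) : nat :=
  if l is k :: l' then
    fock_count (k :: u) l' +
    (if u is k0 :: u' then if good_pair k0 k then fock_count u' l' else 0 else 0)
  else nilp u.

Definition flip (T : Type) (x : T * T) : T * T := (x.2, x.1).

Lemma flipK (T : Type) : involutive (@flip T).
Proof. by case. Qed.

Definition entry_cov (F : numFieldType) (n : nat) (x y : 'I_n * 'I_n) : F :=
  if x == flip y then n%:R^-1 else 0.

(** * Matching the positions of permuted entries *)

Section EntryPairs.
Variable N : nat.
Local Notation I := 'I_(N * N).
Implicit Types (a i j : I).

Lemma pair_idx_inj (a b c d : 'I_N) :
  pair_idx a b = pair_idx c d -> a = c /\ b = d.
Proof.
move=> /[dup] /(congr1 (@quo_idx N)) + /(congr1 (@rem_idx N)).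
by rewrite !quo_pair_idx !rem_pair_idx.
Qed.

(* [case] on such an equality would also unfold the ordinals. *)
Lemma pair_eq_inv (a b c d : I) : (a, b) = (c, d) -> a = c /\ b = d.
Proof. by case. Qed.

Lemma partial_transposeE i j : partial_transpose N (i, j) =
  (pair_idx (quo_idx i) (rem_idx j), pair_idx (quo_idx j) (rem_idx i)).
Proof. by rewrite permE. Qed.

Lemma mixing_mapE i j : mixing_map N (i, j) =
  (pair_idx (quo_idx i) (quo_idx j), pair_idx (rem_idx i) (rem_idx j)).
Proof. by rewrite permE. Qed.

(** The identity and the partial transpose commute with [flip], so the two adjacent positions match
    for every value of the shared index [i] as soon as the outer indices agree. *)
Lemma good_pairE k0 k a i j : good_pair k0 k ->
  (entry_perm N k0 (a, i) == flip (entry_perm N k (i, j))) = (a == j).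
Proof.
rewrite /good_pair => /andP[/eqP -> {k0}].
case: k => -[|[|[]]]// ? _; rewrite /entry_perm !(tnth_nth 1%g)/=.
- by rewrite !perm1 /flip/= xpair_eqE eqxx andbT.
- rewrite !partial_transposeE /flip/=; apply/idP/idP; last first.
    by move=> /eqP aj; rewrite aj.
  by move=> /eqP H; have [/pair_idx_inj[qa _] /pair_idx_inj[_ ra]] := pair_eq_inv H;
    apply/eqP; rewrite -(pair_quo_rem_idx a) -(pair_quo_rem_idx j) qa ra.
Qed.

(** One of the two base-N digits of the shared index [i] is prescribed by [a], which leaves N of its
    N^2 values: the loss of a factor N. *)
Lemma bad_pairP k0 k a : ~~ good_pair k0 k ->
  exists f c, (f = @quo_idx N \/ f = @rem_idx N) /\
  forall i j, entry_perm N k0 (a, i) = flip (entry_perm N k (i, j)) -> f i = c.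
Proof.
rewrite /good_pair /flip; case: k0 => -[|[|[]]]// ?; case: k => -[|[|[]]]// ? _;
  rewrite /entry_perm !(tnth_nth 1%g)/=.
- exists (@rem_idx N), (rem_idx a); split; first by right.
  move=> i j; rewrite perm1 partial_transposeE/= => /pair_eq_inv[-> _].
  by rewrite rem_pair_idx.
- exists (@rem_idx N), (quo_idx a); split; first by right.
  by move=> i j; rewrite perm1 mixing_mapE/= => /pair_eq_inv[-> _]; rewrite quo_pair_idx.
- exists (@rem_idx N), (rem_idx a); split; first by right.
  move=> i j; rewrite perm1 partial_transposeE/= => /pair_eq_inv[_ /(congr1 (@rem_idx N))].
  by rewrite rem_pair_idx.
- exists (@rem_idx N), (quo_idx a); split; first by right.
  move=> i j; rewrite mixing_mapE partial_transposeE/= => /pair_eq_inv[+ _].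
  by move=> /pair_idx_inj[].
- exists (@quo_idx N), (rem_idx a); split; first by left.
  move=> i j; rewrite perm1 mixing_mapE/= => /pair_eq_inv[_ /(congr1 (@quo_idx N))].
  by rewrite quo_pair_idx.
- exists (@quo_idx N), (rem_idx a); split; first by left.
  move=> i j; rewrite mixing_mapE partial_transposeE/= => /pair_eq_inv[_].
  by move=> /pair_idx_inj[].
- exists (@rem_idx N), (quo_idx a); split; first by right.
  by move=> i j; rewrite !mixing_mapE/= => /pair_eq_inv[/pair_idx_inj[]].
Qed.

End EntryPairs.

(** * Crude bounds on sums over index paths *)

Section WickExpansion.
Variables (F : numFieldType) (N : nat).
Hypothesis N0 : (0 < N)%N.
Local Notation I := 'I_(N * N).
Local Notation E := (I * I)%type.
Local Notation sg := (entry_perm N).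
Implicit Types (i j : I) (st : seq E) (u l : seq 'I_3).

Let n : F := (N * N)%:R.
Let n0 : n != 0. Proof. by rewrite pnatr_eq0 -lt0n muln_gt0 N0. Qed.
Let ngt0 : 0 < n. Proof. by rewrite lt0r n0 ler0n. Qed.

Local Notation entry_cov := (@entry_cov F (N * N)).

Lemma entry_cov_ge0 x y : 0 <= entry_cov x y.
Proof. by rewrite /entry_cov; case: ifP => // _; rewrite invr_ge0 ler0n. Qed.

Local Notation W := (wick entry_cov).

Lemma wick_ge0 st e : 0 <= W st e.
Proof.
elim: e st => [|x e IH] st /=; first exact: ler0n.
by rewrite addr_ge0// sumr_ge0// => p _; rewrite mulr_ge0// entry_cov_ge0.
Qed.

(** The monomials in the expansion of the (i, j) entry of a product of matrices, one for each choice
    of the inner indices. *)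
Fixpoint paths l i j : seq (seq E) :=
  if l is k :: l' then [seq sg k (i, i') :: e | i' <- enum I, e <- paths l' i' j]
  else if i == j then [:: [::]] else [::].

Definition path_wick j st i l : F := \sum_(e <- paths l i j) W st e.

Lemma path_wick_ge0 j st i l : 0 <= path_wick j st i l.
Proof. by apply: sumr_ge0 => *; exact: wick_ge0. Qed.

Lemma path_wick_cons j st i k l : path_wick j st i (k :: l) =
  \sum_i' (path_wick j (sg k (i, i') :: st) i' l +
    \sum_(p <- picks st) entry_cov p.1 (sg k (i, i')) * path_wick j p.2 i' l).
Proof.
rewrite /path_wick /= big_allpairs_dep big_enum/=; apply: eq_bigr => i' _.
rewrite big_split/= exchange_big/=; congr (_ + _).
by apply: eq_bigr => p _; rewrite mulr_sumr.
Qed.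

(** Counts the histories of [r] steps from a stack of height [m], those that end with open letters
    included: it serves only as an upper bound. *)
Fixpoint pairing_count (m r : nat) : nat :=
  if r is r'.+1 then pairing_count m.+1 r' + m * pairing_count m.-1 r' else 1.

Lemma sum_entry_cov_le x k i : \sum_i' entry_cov x (sg k (i, i')) <= n^-1.
Proof.
pose c := ((sg k)^-1%g (flip x)).2.
apply: (@le_trans _ _ (\sum_i' if i' == c then n^-1 else 0)).
  apply: ler_sum => i' _; rewrite /entry_cov; case: eqP => [xE|_].
    have -> : i' == c by rewrite /c xE /flip/= -surjective_pairing permK.
    exact: lexx.
  by case: ifP => // _; rewrite invr_ge0 ltW.
by rewrite -big_mkcond big_pred1_eq.
Qed.

(** The letter [x] determines the whole position, so the free row index is lost too: the bound is
    that of [sum_entry_cov_le], without a factor n for the sum over [i]. *)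
Lemma sum2_entry_cov_le x k : \sum_i \sum_i' entry_cov x (sg k (i, i')) <= n^-1.
Proof.
pose c := (sg k)^-1%g (flip x).
apply: (@le_trans _ _ (\sum_i if i == c.1 then n^-1 else 0)).
  apply: ler_sum => i _; case: eqP => [->|ic]; first exact: sum_entry_cov_le.
  rewrite big1// => i' _; rewrite /entry_cov; case: eqP => // xE.
  by case: ic; rewrite /c xE /flip/= -surjective_pairing permK.
by rewrite -big_mkcond big_pred1_eq.
Qed.

Lemma sum_coordinate (f : I -> 'I_N) c : f = @quo_idx N \/ f = @rem_idx N ->
  \sum_i (if f i == c then n^-1 else 0) = N%:R * n^-1.
Proof.
have bij : bijective (fun p : 'I_N * 'I_N => pair_idx p.1 p.2).
  exists (fun i => (quo_idx i, rem_idx i)) => [[a b]|i]/=.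
    by rewrite quo_pair_idx rem_pair_idx.
  exact: pair_quo_rem_idx.
rewrite (reindex _ (onW_bij _ bij))/=.
rewrite -(pair_bigA _ (fun a b => if f (pair_idx a b) == c then n^-1 else 0))/=.
have sum1 : \sum_(b < N) (if b == c then n^-1 else 0) = n^-1.
  by rewrite -big_mkcond big_pred1_eq.
have sumN (x : F) : \sum_(b < N) x = N%:R * x.
  by rewrite sumr_const card_ord mulr_natl.
case=> ->.
- under eq_bigr do under eq_bigr do rewrite quo_pair_idx.
  by rewrite exchange_big/= -sumN; apply: eq_bigr.
- under eq_bigr do under eq_bigr do rewrite rem_pair_idx.
  by rewrite -sumN; apply: eq_bigr.
Qed.

Lemma bad_pair_sum_le k0 k a : ~~ good_pair k0 k ->
  \sum_i \sum_i' entry_cov (sg k0 (a, i)) (sg k (i, i')) <= N%:R * n^-1.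
Proof.
move=> /(bad_pairP a)[f [c [fE fc]]].
rewrite -(sum_coordinate c fE); apply: ler_sum => i _.
case: eqP => [_|fi]; first exact: sum_entry_cov_le.
rewrite big1// => i' _; rewrite /entry_cov; case: eqP => // /fc fic.
by case: fi.
Qed.

(** The powers of n balance: a push brings n values of a new index and one more letter on the stack;
    a closing brings n^-1 by [sum_entry_cov_le] and one letter less. *)
Lemma path_wick_le j st i l :
  path_wick j st i l <= (pairing_count (size st) (size l))%:R * n ^- size st.
Proof.
elim: l st i => [|k l IH] st i.
  rewrite /path_wick /=; case: eqP => _; last first.
    by rewrite big_nil mul1r invr_ge0 exprn_ge0// ltW.
  rewrite big_seq1 /= mul1r; case: st => [|x st]/=; first by rewrite expr0 invr1.
  by rewrite invr_ge0 exprn_ge0// ltW.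
rewrite path_wick_cons big_split/= natrD mulrDl lerD//.
  apply: (le_trans (ler_sum _ (fun i' _ => IH (sg k (i, i') :: st) i'))) => /=.
  rewrite sumr_const card_ord -[_ *+ (N * N)]mulr_natr -mulrA ler_wpM2l//.
  by rewrite exprS invfM mulrAC -/n mulVf// mul1r.
rewrite exchange_big/= natrM.
apply: (@le_trans _ _ (\sum_(p <- picks st)
    n^-1 * ((pairing_count (size st).-1 (size l))%:R * n ^- (size st).-1))).
  rewrite big_seq [leRHS]big_seq; apply: ler_sum => p /size_pick <-.
  apply: (@le_trans _ _ (\sum_i' entry_cov p.1 (sg k (i, i')) *
    ((pairing_count (size p.2) (size l))%:R * n ^- size p.2))).
    by apply: ler_sum => i' _; rewrite ler_wpM2l ?entry_cov_ge0.
  rewrite -mulr_suml ler_wpM2r ?sum_entry_cov_le//.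
  by rewrite mulr_ge0// invr_ge0 exprn_ge0// ltW.
rewrite big_const_seq count_predT size_picks iter_addr addr0 -[_ *+ size st]mulr_natl.
case: (size st) => [|m] /=; first by rewrite !mul0r.
by rewrite -[leRHS]mulrA ler_wpM2l// mulrCA -invfM -exprS.
Qed.

End WickExpansion.

(** * The first closing and the limit of the sums *)

Section FockLimit.
Variables (F : numFieldType) (N : nat).
Hypothesis N0 : (0 < N)%N.
Local Notation I := 'I_(N * N).
Local Notation E := (I * I)%type.
Local Notation sg := (entry_perm N).
Local Notation cov := (@entry_cov F (N * N)).
Local Notation phi := (@path_wick F N).
Implicit Types (i j : I) (st : seq E) (u l : seq 'I_3).

Let n : F := (N * N)%:R.
Let n0 : n != 0. Proof. by rewrite pnatr_eq0 -lt0n muln_gt0 N0. Qed.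
Let ngt0 : 0 < n. Proof. by rewrite lt0r n0 ler0n. Qed.

(* The triples (first index, stack, current index) reached by reading the
   letters of [u], most recent first, without closing any pair. *)
Fixpoint open_paths u : seq (I * seq E * I) :=
  if u is k :: u' then
    [seq (t.1.1, sg k (t.2, i) :: t.1.2, i) | t <- open_paths u', i <- enum I]
  else [seq (i, [::], i) | i <- enum I].

(** For empty [u] this is the expected unnormalized trace of the word [l]; the induction on the
    letters still to be read needs every [u]. *)
Definition open_sum u l : F := \sum_(t <- open_paths u) phi t.1.1 t.1.2 t.2 l.

Lemma size_open_paths u : size (open_paths u) = ((N * N) ^ (size u).+1)%N.
Proof.
elim: u => [|k u IH] /=; first by rewrite size_map size_enum_ord.
by rewrite size_allpairs IH size_enum_ord -expnSr.
Qed.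

Lemma size_stack u t : t \in open_paths u -> size t.1.2 = size u.
Proof.
elim: u t => [|k u IH] t /=; first by case/mapP => i _ ->.
by case/allpairsP => -[t' i]/= [/IH <- _ ->].
Qed.

Lemma open_sum_nil u : open_sum u [::] = if nilp u then n else 0.
Proof.
rewrite /open_sum; case: u => [|k u]/=.
  rewrite big_map big_enum/= (eq_bigr (fun=> 1)) => [|i _].
    by rewrite sumr_const card_ord.
  by rewrite /path_wick/= eqxx big_seq1.
rewrite big_allpairs_dep big1// => t _; rewrite big1// => i _.
by rewrite /path_wick/=; case: eqP => _; rewrite ?big_seq1 ?big_nil.
Qed.

Let closing u k l : F := \sum_(t <- open_paths u) \sum_i'
  \sum_(p <- picks t.1.2) cov p.1 (sg k (t.2, i')) * phi t.1.1 p.2 i' l.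

Lemma open_sum_cons u k l : open_sum u (k :: l) = open_sum (k :: u) l + closing u k l.
Proof.
rewrite /open_sum /= big_allpairs_dep -big_split/=; apply: eq_bigr => t _.
by rewrite path_wick_cons big_split/= big_enum.
Qed.

Let C u l : F := (pairing_count (size u) (size l))%:R.

Let top u k0 k l : F := \sum_(t <- open_paths u) \sum_i \sum_i'
  cov (sg k0 (t.2, i)) (sg k (i, i')) * phi t.1.1 t.1.2 i' l.

Let deeper u k0 k l : F := \sum_(t <- open_paths u) \sum_i \sum_i'
  \sum_(p <- picks t.1.2) cov p.1 (sg k (i, i')) *
    phi t.1.1 (sg k0 (t.2, i) :: p.2) i' l.

Let closing_cons u k0 k l : closing (k0 :: u) k l = top u k0 k l + deeper u k0 k l.
Proof.
rewrite /closing /top /deeper /= big_allpairs_dep -big_split/=.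
apply: eq_bigr => t _; rewrite big_enum -big_split/=; apply: eq_bigr => i _.
rewrite -big_split/=; apply: eq_bigr => i' _.
by rewrite big_cons big_map/=.
Qed.

(** Only [i' = t.2] contributes, and there each of the n values of [i] has weight n^-1. *)
Let top_good u k0 k l : good_pair k0 k -> top u k0 k l = open_sum u l.
Proof.
move=> good; apply: eq_bigr => t _; rewrite exchange_big/=.
rewrite (bigD1 t.2)//= [X in _ + X]big1 => [|i' i't].
  rewrite addr0 (eq_bigr (fun=> n^-1 * phi t.1.1 t.1.2 t.2 l)) => [|i _].
    by rewrite sumr_const card_ord -[LHS]mulr_natl mulVKf.
  by rewrite /entry_cov good_pairE// eqxx.
rewrite big1// => i _; rewrite /entry_cov good_pairE// eq_sym (negbTE i't).
by rewrite mul0r.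
Qed.

Let expn_size (x : F) u :
  (x * n ^- size u) *+ (N * N) ^ (size u).+1 = x * n.
Proof.
rewrite -[LHS]mulr_natr natrX exprSr -!mulrA [_ * (_ * n)]mulrA mulVf ?mul1r//.
exact: expf_neq0.
Qed.

(** There are n^(size u + 1) open paths; each contributes at most N n^-1 for the closing and [C u l]
    n^-(size u) for the rest. *)
Let top_bad u k0 k l : ~~ good_pair k0 k -> top u k0 k l <= C u l * N%:R.
Proof.
move=> bad; rewrite /top.
apply: (@le_trans _ _ (\sum_(t <- open_paths u) (N%:R * n^-1) * (C u l * n ^- size u))).
  rewrite big_seq [leRHS]big_seq; apply: ler_sum => t /size_stack tu.
  rewrite (le_trans _ (ler_wpM2r _ (bad_pair_sum_le F N0 t.2 bad)))//; last first.
    by rewrite mulr_ge0// invr_ge0 exprn_ge0// ltW.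
  rewrite mulr_suml; apply: ler_sum => i _; rewrite mulr_suml.
  apply: ler_sum => i' _; rewrite ler_wpM2l ?entry_cov_ge0//.
  by rewrite /C -tu; exact: path_wick_le.
rewrite big_const_seq count_predT size_open_paths iter_addr addr0.
by rewrite mulrA expn_size mulrAC divfK// mulrC.
Qed.

(** Here both digits of the last index are prescribed and the sum is even bounded in N; the factor N
    only matches [top_bad]. *)
Let deeper_le u k0 k l : deeper u k0 k l <= (size u)%:R * C u l * N%:R.
Proof.
rewrite /deeper.
apply: (@le_trans _ _ (\sum_(t <- open_paths u)
    ((n^-1 * (C u l * n ^- size u)) *+ size u))).
  rewrite big_seq [leRHS]big_seq; apply: ler_sum => t /size_stack tu.
  under eq_bigr do rewrite exchange_big/=.
  rewrite exchange_big/=.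
  apply: (@le_trans _ _ (\sum_(p <- picks t.1.2) n^-1 * (C u l * n ^- size u))).
    rewrite big_seq [leRHS]big_seq; apply: ler_sum => p /[dup] pt /size_pick pu.
    rewrite (le_trans _ (ler_wpM2r _ (sum2_entry_cov_le F N0 p.1 k)))//; last first.
      by rewrite mulr_ge0// invr_ge0 exprn_ge0// ltW.
    rewrite mulr_suml; apply: ler_sum => i _; rewrite mulr_suml.
    apply: ler_sum => i' _; rewrite ler_wpM2l ?entry_cov_ge0//.
    have su : size u = (size p.2).+1.
      by rewrite pu -tu prednK// lt0n size_eq0; case: (t.1.2) pt.
    by rewrite /C su; exact: path_wick_le.
  by rewrite big_const_seq count_predT size_picks iter_addr addr0 tu.
rewrite big_const_seq count_predT size_open_paths iter_addr addr0.
rewrite -mulrnA mulnC mulrnA mulrA expn_size mulrAC mulVf// mul1r -[leLHS]mulr_natl.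
by rewrite ler_peMr ?mulr_ge0// ler1n.
Qed.

Let deeper_ge0 u k0 k l : 0 <= deeper u k0 k l.
Proof.
by do 4 (apply: sumr_ge0 => ? _); rewrite mulr_ge0 ?entry_cov_ge0 ?path_wick_ge0.
Qed.

Let top_ge0 u k0 k l : 0 <= top u k0 k l.
Proof.
by do 3 (apply: sumr_ge0 => ? _); rewrite mulr_ge0 ?entry_cov_ge0 ?path_wick_ge0.
Qed.

Lemma open_sum_cons_nil k l : open_sum [::] (k :: l) = open_sum [:: k] l.
Proof.
rewrite open_sum_cons /closing [X in _ + X]big1_seq ?addr0// => t.
move=> /andP[_] /size_stack/size0nil -> /=.
by rewrite big1// => i _; rewrite big_nil.
Qed.

Lemma open_sum_cons_cons k0 u k l :
  `|open_sum (k0 :: u) (k :: l) - (open_sum [:: k, k0 & u] l +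
      (if good_pair k0 k then open_sum u l else 0))| <=
  ((size u).+1 * pairing_count (size u) (size l))%:R * N%:R.
Proof.
rewrite open_sum_cons closing_cons.
set g := (if _ then _ else _); set o := open_sum _ l.
have -> : o + (top u k0 k l + deeper u k0 k l) - (o + g) =
    top u k0 k l - g + deeper u k0 k l by ring.
rewrite natrM -addn1 natrD mulrDl mul1r mulrDl {}/g.
case: ifPn => good.
  rewrite top_good// subrr add0r.
  rewrite ger0_norm ?deeper_ge0// (le_trans (deeper_le _ _ _ _))//.
  by rewrite lerDl mulr_ge0.
rewrite subr0 ger0_norm ?addr_ge0// addrC lerD ?deeper_le//.
exact: top_bad.
Qed.

End FockLimit.

Lemma fock_count_limit (F : numFieldType) u l : exists K : nat,
  forall N, (0 < N)%N ->
  `|open_sum F N u l - (fock_count u l)%:R * (N * N)%:R| <= K%:R * N%:R.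
Proof.
elim: l u => [|k l IH] u.
  exists 0 => N N0; rewrite open_sum_nil/=.
  by case: (nilp u); rewrite !(mul1r, mul0r) subrr normr0.
have [K KP] := IH (k :: u).
case: u => [|k0 u] in KP *.
  by exists K => N N0; rewrite open_sum_cons_nil// /= addn0; exact: KP.
have [K' KP'] := IH u.
exists (((size u).+1 * pairing_count (size u) (size l)) + K + K')%N => N N0.
rewrite -[X in `|X|](subrKA (open_sum F N [:: k, k0 & u] l +
  (if good_pair k0 k then open_sum F N u l else 0))).
rewrite (le_trans (ler_normD _ _))// -addnA natrD mulrDl lerD//.
  exact: open_sum_cons_cons.
rewrite /= natrD (mulrDl (fock_count _ _)%:R) opprD addrACA.
rewrite (le_trans (ler_normD _ _))// natrD mulrDl lerD//; first exact: KP.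
case: ifP => _; first exact: KP'.
by rewrite mul0r subrr normr0 mulr_ge0.
Qed.

(** * The full Fock space *)

Section PolyInner.
Variable C : numClosedFieldType.
Implicit Types (u v w : {poly C}).

(** Antilinear in [u], with orthonormal monomials. No completion is taken: a word in the operators
    maps the vacuum to a finite combination of basis vectors. *)
Definition poly_inner u v : C := \sum_(i < size u) (u`_i)^* * v`_i.

Lemma poly_innerE n u v : (size u <= n)%N ->
  poly_inner u v = \sum_(i < n) (u`_i)^* * v`_i.
Proof.
move=> un; rewrite /poly_inner (big_ord_widen n (fun i => (u`_i)^* * v`_i))//.
rewrite big_mkcond; apply: eq_bigr => i _; case: ltnP => // ui.
by rewrite nth_default// conjC0 mul0r.
Qed.

Lemma poly_innerDl v : {morph poly_inner^~ v : u w / u + w}.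
Proof.
move=> u w; have le1 := leq_maxl (size u) (size w).
have le2 := leq_maxr (size u) (size w).
rewrite (poly_innerE _ le1) (poly_innerE _ le2).
rewrite (poly_innerE _ (size_polyD u w)).
by rewrite -big_split; apply: eq_bigr => i _; rewrite coefD rmorphD mulrDl.
Qed.

Lemma poly_innerDr u : {morph poly_inner u : v w / v + w}.
Proof.
by move=> v w; rewrite -big_split; apply: eq_bigr => i _; rewrite coefD mulrDr.
Qed.

Lemma poly_innerZr a u v : poly_inner u (a *: v) = a * poly_inner u v.
Proof.
by rewrite mulr_sumr; apply: eq_bigr => i _; rewrite coefZ mulrCA.
Qed.

Lemma poly_innerC u v : poly_inner u v = (poly_inner v u)^*.
Proof.
have le1 := leq_maxl (size u) (size v); have le2 := leq_maxr (size u) (size v).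
rewrite (poly_innerE _ le1) (poly_innerE _ le2) rmorph_sum.
by apply: eq_bigr => i _; rewrite rmorphM/= conjCK mulrC.
Qed.

Lemma poly_innerZl a u v : poly_inner (a *: u) v = a^* * poly_inner u v.
Proof. by rewrite poly_innerC poly_innerZr rmorphM/= -poly_innerC. Qed.

Lemma poly_inner0l v : poly_inner 0 v = 0.
Proof. by rewrite /poly_inner size_poly0 big_ord0. Qed.

Lemma poly_inner_suml (I : Type) (r : seq I) (f : I -> {poly C}) v :
  poly_inner (\sum_(i <- r) f i) v = \sum_(i <- r) poly_inner (f i) v.
Proof. exact: (big_morph _ (poly_innerDl v) (poly_inner0l v)). Qed.

Lemma poly_innerXn k v : poly_inner 'X^k v = v`_k.
Proof.
rewrite /poly_inner size_polyXn big_ord_recr/= coefXn eqxx conjC1 mul1r.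
rewrite big1 ?add0r// => i _; rewrite coefXn ltn_eqF//.
by rewrite conjC0 mul0r.
Qed.

Lemma poly_inner_eq u v : (forall w, poly_inner w u = poly_inner w v) -> u = v.
Proof. by move=> uv; apply/polyP => i; rewrite -!poly_innerXn. Qed.

Lemma poly_inner_ge0 u : 0 <= poly_inner u u.
Proof. by apply: sumr_ge0 => i _; rewrite mulrC -normCK exprn_ge0. Qed.

(* The full Fock space over a 3-dimensional space: bijective base-3 numeration
   identifies the word w k with 3 w + k + 1, hence its basis with the monomials. *)
Definition creation (k : 'I_3) u : {poly C} :=
  \sum_(i < size u) u`_i *: 'X^((3 * i + k).+1)%N.

Definition annihilation (k : 'I_3) u : {poly C} :=
  \poly_(i < size u) u`_((3 * i + k).+1)%N.

Lemma coef_annihilation k u i : (annihilation k u)`_i = u`_((3 * i + k).+1)%N.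
Proof.
rewrite coef_poly; case: ltnP => // ui; by rewrite nth_default// (leq_trans ui)//; lia.
Qed.

Lemma creation_adjoint k u v :
  poly_inner (creation k u) v = poly_inner u (annihilation k v).
Proof.
rewrite poly_inner_suml; apply: eq_bigr => i _.
by rewrite poly_innerZl poly_innerXn coef_annihilation.
Qed.

Lemma annihilation_adjoint k u v :
  poly_inner (annihilation k u) v = poly_inner u (creation k v).
Proof. by rewrite poly_innerC -creation_adjoint -poly_innerC. Qed.

Lemma annihilation_creation k j u :
  annihilation k (creation j u) = if k == j then u else 0.
Proof.
apply/polyP => m; rewrite coef_annihilation coef_sum.
case: eqP => [->|kj]; last first.
  rewrite coef0 big1// => i _; rewrite coefZ coefXn.
  case: eqP => [|_]; last by rewrite mulr0.
  by move=> e; case: kj; apply/val_inj => /=; have := ltn_ord k; have := ltn_ord j; lia.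
have [mu|mu] := ltnP m (size u); last first.
  rewrite [RHS]nth_default// big1// => i _; rewrite coefZ coefXn.
  case: eqP => [e|_]; last by rewrite mulr0.
  by exfalso; have := ltn_ord i; lia.
rewrite (bigD1 (Ordinal mu))//= coefZ coefXn eqxx mulr1 big1 ?addr0// => i im.
rewrite coefZ coefXn; case: eqP => [e|_]; last by rewrite mulr0.
by case/eqP: im; apply/val_inj => /=; lia.
Qed.

Lemma annihilation1 k : annihilation k 1 = 0.
Proof. by apply/polyP => i; rewrite coef_annihilation coef0 coef1. Qed.

Lemma coef0_creation k u : (creation k u)`_0 = 0.
Proof. by rewrite coef_sum big1// => i _; rewrite coefZ coefXn mulr0. Qed.

End PolyInner.

(** * The star-algebra of adjointable operators and its vacuum state *)

Section AdjointableOperators.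
Variable C : numClosedFieldType.
Local Notation V := {poly C}.
Local Notation "<| u , v |>" := (poly_inner u v) (at level 0).

(** Linearity follows from the existence of an adjoint. The adjoint is stored to make the star a
    function; it is unique, so operators with the same values are equal. *)
Record adjointable := Adjointable {
  adj_fun :> V -> V;
  adj_adj : V -> V;
  adj_funP : forall u v, <| adj_fun u, v |> = <| u, adj_adj v |>
}.

HB.instance Definition _ := gen_eqMixin adjointable.
HB.instance Definition _ := gen_choiceMixin adjointable.

Implicit Types (x y z : adjointable) (u v : V).

Lemma adj_adjP x u v : <| adj_adj x u, v |> = <| u, x v |>.
Proof. by rewrite poly_innerC -adj_funP -poly_innerC. Qed.

Lemma adjointable_eq x y : (forall u, x u = y u) -> x = y.
Proof.
case: x y => f f' fP [g g' gP] /= fg.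
have efg : f = g by apply/funext.
have efg' : f' = g'.
  by apply/funext => v; apply: poly_inner_eq => w; rewrite -fP -gP fg.
by subst; congr Adjointable; exact: Prop_irrelevance.
Qed.

Lemma adjointableD x u v : x (u + v) = x u + x v.
Proof.
apply: poly_inner_eq => w; rewrite poly_innerDr -!adj_adjP.
exact: poly_innerDr.
Qed.

Lemma adjointableZ x a u : x (a *: u) = a *: x u.
Proof. by apply: poly_inner_eq => w; rewrite poly_innerZr -!adj_adjP poly_innerZr. Qed.

Lemma adjointable0 x : x 0 = 0.
Proof. by rewrite -(scale0r 0) adjointableZ !scale0r. Qed.

Fact adj_zeroP u v : <| 0, v |> = <| u, 0 |>.
Proof. by rewrite poly_inner0l poly_innerC poly_inner0l conjC0. Qed.
Definition adj_zero := @Adjointable (fun=> 0) (fun=> 0) adj_zeroP.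

Fact adj_oppP x u v : <| - x u, v |> = <| u, - adj_adj x v |>.
Proof.
rewrite -(scaleN1r (x u)) -(scaleN1r (adj_adj x v)).
by rewrite poly_innerZl poly_innerZr adj_funP rmorphN1.
Qed.
Definition adj_opp x := Adjointable (adj_oppP x).

Fact adj_addP x y u v : <| x u + y u, v |> = <| u, adj_adj x v + adj_adj y v |>.
Proof. by rewrite poly_innerDl poly_innerDr !adj_funP. Qed.
Definition adj_add x y := Adjointable (adj_addP x y).

Definition adj_one := @Adjointable id id (fun u v => erefl).

Fact adj_mulP x y u v : <| x (y u), v |> = <| u, adj_adj y (adj_adj x v) |>.
Proof. by rewrite !adj_funP. Qed.
Definition adj_mul x y := Adjointable (adj_mulP x y).

Fact adj_scaleP a x u v : <| a *: x u, v |> = <| u, a^* *: adj_adj x v |>.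
Proof. by rewrite poly_innerZl poly_innerZr adj_funP. Qed.
Definition adj_scale a x := Adjointable (adj_scaleP a x).

Definition adj_star x := Adjointable (adj_adjP x).

Fact adj_addA : associative adj_add.
Proof. by move=> x y z; apply: adjointable_eq => u /=; rewrite addrA. Qed.
Fact adj_addC : commutative adj_add.
Proof. by move=> x y; apply: adjointable_eq => u /=; rewrite addrC. Qed.
Fact adj_add0 : left_id adj_zero adj_add.
Proof. by move=> x; apply: adjointable_eq => u /=; rewrite add0r. Qed.
Fact adj_addN : left_inverse adj_zero adj_opp adj_add.
Proof. by move=> x; apply: adjointable_eq => u /=; rewrite addNr. Qed.

HB.instance Definition _ :=
  GRing.isZmodule.Build adjointable adj_addA adj_addC adj_add0 adj_addN.

Fact adj_mulA : associative adj_mul.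
Proof. by move=> x y z; apply: adjointable_eq. Qed.
Fact adj_mul1 : left_id adj_one adj_mul.
Proof. by move=> x; apply: adjointable_eq. Qed.
Fact adj_1mul : right_id adj_one adj_mul.
Proof. by move=> x; apply: adjointable_eq. Qed.
Fact adj_mulDl : left_distributive adj_mul adj_add.
Proof. by move=> x y z; apply: adjointable_eq. Qed.
Fact adj_mulDr : right_distributive adj_mul adj_add.
Proof. by move=> x y z; apply: adjointable_eq => u /=; rewrite adjointableD. Qed.
Fact adj_one_neq0 : adj_one != adj_zero.
Proof.
apply/eqP => /(congr1 (fun x : adjointable => x 1))/= /eqP.
by rewrite oner_eq0.
Qed.

HB.instance Definition _ := GRing.Zmodule_isNzRing.Build adjointable
  adj_mulA adj_mul1 adj_1mul adj_mulDl adj_mulDr adj_one_neq0.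

Fact adj_scaleA a b x : adj_scale a (adj_scale b x) = adj_scale (a * b) x.
Proof. by apply: adjointable_eq => u /=; rewrite scalerA. Qed.
Fact adj_scale1 : left_id 1 adj_scale.
Proof. by move=> x; apply: adjointable_eq => u /=; rewrite scale1r. Qed.
Fact adj_scaleDr : right_distributive adj_scale +%R.
Proof. by move=> a x y; apply: adjointable_eq => u /=; rewrite scalerDr. Qed.
Fact adj_scaleDl x : {morph adj_scale^~ x : a b / a + b}.
Proof. by move=> a b; apply: adjointable_eq => u /=; rewrite scalerDl. Qed.

HB.instance Definition _ := GRing.Zmodule_isLmodule.Build C adjointable
  adj_scaleA adj_scale1 adj_scaleDr adj_scaleDl.

Fact adj_scaleAl a x y : a *: (x * y) = (a *: x) * y.
Proof. by apply: adjointable_eq. Qed.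
HB.instance Definition _ := GRing.Lmodule_isLalgebra.Build C adjointable adj_scaleAl.

Fact adj_scaleAr a x y : a *: (x * y) = x * (a *: y).
Proof. by apply: adjointable_eq => u /=; rewrite adjointableZ. Qed.
HB.instance Definition _ := GRing.Lalgebra_isAlgebra.Build C adjointable adj_scaleAr.

Definition vacuum_state x : C := (x 1)`_0.

Fact vacuum_state_linear : scalar vacuum_state.
Proof. by move=> a x y; rewrite /vacuum_state /= coefD coefZ. Qed.
HB.instance Definition _ :=
  GRing.isLinear.Build C adjointable C *%R vacuum_state vacuum_state_linear.

Lemma vacuum_stateE x : vacuum_state x = <| 1, x 1 |>.
Proof. by rewrite /vacuum_state -poly_innerXn expr0. Qed.

End AdjointableOperators.

(** * Freeness and moments of the limit operators *)

Section FreeLimit.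
Variable C : numClosedFieldType.
Local Notation A := (adjointable C).
Local Notation V := {poly C}.
Implicit Types (k : 'I_3) (x : A) (p q : V) (u v : V).

Lemma adj_starD : {morph @adj_star C : x y / x + y}.
Proof. by move=> x y; apply: adjointable_eq. Qed.

Lemma adj_starZ (a : C) x : adj_star (a *: x) = a^* *: adj_star x.
Proof. by apply: adjointable_eq. Qed.

Lemma adj_starM x y : adj_star (x * y) = adj_star y * adj_star x.
Proof. by apply: adjointable_eq. Qed.

Lemma adj_starK : involutive (@adj_star C).
Proof. by move=> x; apply: adjointable_eq. Qed.

Lemma vacuum_state1 : vacuum_state (1 : A) = 1.
Proof. by rewrite /vacuum_state coef1. Qed.

Lemma vacuum_state_ge0 x : 0 <= vacuum_state (adj_star x * x).
Proof. by rewrite vacuum_stateE /= -adj_funP poly_inner_ge0. Qed.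

Definition fock_space : ncps C := @NCPS C A (@adj_star C) (@vacuum_state C)
  adj_starD adj_starZ adj_starM adj_starK vacuum_state1 vacuum_state_ge0.

Definition creation_op k : A := Adjointable (@creation_adjoint C k).
Definition annihilation_op k : A := Adjointable (@annihilation_adjoint C k).

(* The mixed matrices have no nonzero limit moment: among the star-free words,
   an annihilation operator is a limit for them. *)
Definition limit_op k : A :=
  annihilation_op k + (if k == ord_max then 0 else creation_op k).

Let horner_op x p v : V := (horner_alg x p : A) v.

Let horner_opXDC x p c v :
  horner_op x (p * 'X + c%:P) v = x (horner_op x p v) + c *: v.
Proof.
by rewrite /horner_op mulrC rmorphD rmorphM /= horner_algX horner_algC.
Qed.

Let horner_op0 x v : horner_op x 0 v = 0.
Proof. by rewrite /horner_op rmorph0. Qed.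

Let horner_opD x p q v : horner_op x (p + q) v = horner_op x p v + horner_op x q v.
Proof. by rewrite /horner_op rmorphD. Qed.

Let annihilation_horner k q : exists q', forall v, annihilation k v = 0 ->
  annihilation k (horner_op (creation_op k) q v) = horner_op (creation_op k) q' v.
Proof.
elim/poly_ind: q => [|q c _].
  by exists 0 => v kv; rewrite !horner_op0; exact: (adjointable0 (annihilation_op k)).
(* The annihilation operator cancels one creation and kills the constant term, which is division by
   the variable. *)
exists q => v kv; rewrite horner_opXDC.
rewrite -[annihilation k]/(annihilation_op k : V -> V).
rewrite adjointableD adjointableZ /= kv scaler0 addr0.
by rewrite annihilation_creation eqxx.
Qed.

(* On the kernel of the annihilation operator a polynomial in [limit_op k] acts
   as a polynomial in the creation operator. *)
Let limit_op_normal k p : exists q, forall v, annihilation k v = 0 ->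
  horner_op (limit_op k) p v = horner_op (creation_op k) q v.
Proof.
elim/poly_ind: p => [|p c [q qP]]; first by exists 0 => v _; rewrite !horner_op0.
have [q' q'P] := annihilation_horner k q.
exists (q' + (if k == ord_max then 0 else q * 'X) + c%:P) => v kv.
have cE r : horner_op r c%:P v = c *: v.
  by rewrite -[c%:P]add0r -(mul0r 'X) horner_opXDC horner_op0 adjointable0 add0r.
rewrite horner_opXDC qP// !horner_opD cE -q'P//; congr (_ + _).
rewrite /limit_op /=; congr (_ + _); case: ifP => _; first by rewrite horner_op0.
by rewrite -[q * 'X]addr0 horner_opXDC scale0r addr0.
Qed.

(** At the vacuum, the constant coefficient of the normal form is the state of [x]. Once it
    vanishes, a creation operator factors out on the left. *)
Let centered_range k (x : fock_space) v : unital_subalgebra (limit_op k : fock_space) x ->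
  vacuum_state x = 0 -> annihilation k v = 0 -> exists w, (x : A) v = creation k w.
Proof.
move=> [p ->] x0 kv; have [q qP] := limit_op_normal k p.
move: qP; elim/poly_ind: q => [|q c _] qP.
  exists 0; rewrite -/(horner_op _ _ _) qP// horner_op0.
  by rewrite -[creation k _]/(creation_op k _) adjointable0.
exists (horner_op (creation_op k) q v).
rewrite -/(horner_op _ _ _) qP// horner_opXDC.
suff -> : c = 0 by rewrite scale0r addr0.
move: x0; rewrite /vacuum_state -/(horner_op _ _ _) qP ?annihilation1//.
by rewrite horner_opXDC coefD coef0_creation add0r coefZ coef1 mulr1.
Qed.

(** The factors act on the vacuum from right to left. The vacuum is killed by every annihilation
    operator, and a vector in the range of [creation j] by [annihilation k] for j different from k;
    so each factor maps the vector it meets into the range of its own creation operator, which is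
    orthogonal to the vacuum. *)
Lemma limit_op_free : free_family (limit_op : 'I_3 -> fock_space).
Proof.
move=> r k x r0 kS xk x0.
suff [v vE] : exists v, ((\prod_(s < r) x s : A) 1 = creation (k (Ordinal r0)) v).
  by rewrite -[LHS]/(vacuum_state _) /vacuum_state vE coef0_creation.
elim: r k x r0 kS xk x0 => // r IH k x r0 kS xk x0.
rewrite big_ord_recl.
have -> : Ordinal r0 = ord0 by apply/val_inj.
apply: (centered_range (xk ord0) (x0 ord0)).
case: r => [|r] in IH k x r0 kS xk x0 *; first by rewrite big_ord0 annihilation1.
have [|t|t|v ->] := IH (fun s => k (lift ord0 s)) (fun s => x (lift ord0 s)) (ltn0Sn r).
- by move=> s t st; apply: kS; rewrite /= /bump /= st.
- exact: xk.
- exact: x0.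
rewrite annihilation_creation ifN//; apply/eqP; apply: kS => /=.
by rewrite /bump.
Qed.

Let basis (u : seq 'I_3) : V := foldr (@creation C) 1 u.

(** The leftmost operator is moved to [basis u]: its annihilation part pushes a letter and its
    creation part pops one, so the word is read in the order of [wick]. *)
Let fock_countE (u l : seq 'I_3) :
  poly_inner (basis u) ((\prod_(k <- l) limit_op k : A) 1) = (fock_count u l)%:R.
Proof.
elim: l u => [|k l IH] u.
  rewrite big_nil /= poly_innerC -[X in poly_inner X _](expr0 'X) poly_innerXn.
  by case: u => [|j u] /=; rewrite ?coef1 ?conjC1// coef0_creation conjC0.
rewrite big_cons /= poly_innerDr natrD; congr (_ + _).
  by rewrite -creation_adjoint -(IH (k :: u)).
set w := (\prod_(j <- l) _ : A) 1 in IH *.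
have -> : (if k == ord_max then 0 else creation_op k) w =
    (if k == ord_max then 0 else creation k w) by case: ifP.
case: ifPn => [/eqP -> |k2].
  rewrite poly_innerC poly_inner0l conjC0 /good_pair.
  by case: u => // j u; rewrite eqxx andbF.
rewrite -annihilation_adjoint; case: u => [|j u] /=.
  by rewrite annihilation1 poly_inner0l.
rewrite annihilation_creation /good_pair k2 andbT eq_sym.
by case: ifP => _; rewrite ?poly_inner0l// IH.
Qed.

Lemma limit_op_moment (l : seq 'I_3) :
  ncps_state fock_space (\prod_(k <- l) limit_op k) = (fock_count [::] l)%:R.
Proof. by rewrite -fock_countE -vacuum_stateE. Qed.

End FreeLimit.

(** * Wick's formula for Gaussian matrices *)

Section ComplexMeasurability.
Context d (T : measurableType d) (R : realType).
Implicit Types f g : T -> R[i].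

Definition cmeasurable f : Prop :=
  measurable_fun setT (fun w => complex.Re (f w)) /\
  measurable_fun setT (fun w => complex.Im (f w)).

Lemma cmeasurableM f g : cmeasurable f -> cmeasurable g ->
  cmeasurable (fun w => f w * g w).
Proof.
move=> [fr fi] [gr gi]; split.
- by under eq_fun do rewrite Re_complexM; apply: measurable_funB; exact: measurable_funM.
- by under eq_fun do rewrite Im_complexM; apply: measurable_funD; exact: measurable_funM.
Qed.

Lemma cmeasurableX f k : cmeasurable f -> cmeasurable (fun w => f w ^+ k).
Proof.
move=> mf; elim: k => [|k IH].
  by split; under eq_fun do rewrite expr0; exact: measurable_cst.
by under eq_fun do rewrite exprS; exact: cmeasurableM.
Qed.

Lemma Im_complexJ (x : R[i]) : complex.Im x^* = - complex.Im x.
Proof. by case: x. Qed.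

Lemma Re_complexJ (x : R[i]) : complex.Re x^* = complex.Re x.
Proof. by case: x. Qed.

Lemma cmeasurableC f : cmeasurable f -> cmeasurable (fun w => (f w)^*).
Proof.
move=> [fr fi]; split; first by under eq_fun do rewrite Re_complexJ.
by under eq_fun do rewrite Im_complexJ; exact: measurable_funN.
Qed.

End ComplexMeasurability.

Lemma map_fst_picks (T : Type) (s : seq T) : [seq p.1 | p <- picks s] = s.
Proof. by elim: s => //= x s IH; rewrite -map_comp IH. Qed.

Section GaussianMatrixWick.
Context d (T : measurableType d) (R : realType) (P : probability T R).
Variables (n : nat) (G : T -> 'M[R[i]]_n).
Hypothesis gG : gaussian_matrix P G.
Local Notation E := ('I_n * 'I_n)%type.
Implicit Types (k x : E) (l : seq E).

Let gE k w := G w k.1 k.2.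
Let D : {set E} := [set k : E | (k.1 <= k.2)%N].

Let gE_flip k w : gE (flip k) w = (gE k w)^*.
Proof. by rewrite /gE; case: gG => + _ _ _ _; exact. Qed.

Let Im_diag i w : complex.Im (G w i i) = 0.
Proof.
have [+ _ _ _ _] := gG => /(_ w i i)/(congr1 (@complex.Im R)).
by rewrite Im_complexJ => /eqP; rewrite -addr_eq0 -mulr2n mulrn_eq0/= => /eqP.
Qed.

Let gE_measurable k : cmeasurable (gE k).
Proof.
have [_ _ hdiag hoff _] := gG.
case: k => i j; rewrite /gE/=; have [<-|ij] := eqVneq i j.
  split; first by have [] := hdiag i.
  by under eq_fun do rewrite Im_diag; exact: measurable_cst.
have [cg _] := hoff i j ij; split.
- by have [+ _] := cg 1 0; under eq_fun do rewrite mul1r mul0r addr0.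
- by have [+ _] := cg 0 1; under eq_fun do rewrite mul1r mul0r add0r.
Qed.

Let v : R := n%:R^-1.

Let vC : v%:C%C = n%:R^-1 :> R[i].
Proof. by rewrite fmorphV rmorph_nat. Qed.

Let mu k a b := cexpectation P (fun w => gE k w ^+ a * (gE k w)^* ^+ b).

Let offdiag_moment k : k.1 != k.2 -> forall a b,
  cintegrable P (fun w => gE k w ^+ a * (gE k w)^* ^+ b) /\
  mu k a b = if a == b then a`!%:R * n%:R ^- a else 0.
Proof.
have [_ _ _ hoff hmom] := gG; move=> kk a b.
have [cg Eg2] := hoff _ _ kk; have [Eg Egg] := hmom k.1 k.2.
rewrite -vC in Egg; split.
  exact: (cintegrable_complex_gaussian cg Eg).
rewrite /mu (complex_gaussian_moment cg Eg Eg2 Egg) vC.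
by case: eqP => // _; rewrite exprVn.
Qed.

(** A diagonal entry is real, so the first exponent is enough. At [a = 0] the factor 0 makes the
    truncated [a.-1] harmless. *)
Let diag_moment k : k.1 = k.2 ->
  (forall a, cintegrable P (fun w => gE k w ^+ a * (gE k w)^* ^+ 0)) /\
  (forall a, mu k a.+1 0 = a%:R * n%:R^-1 * mu k a.-1 0).
Proof.
have [_ _ hdiag _ hmom] := gG; case: k => i j /= <-.
have [Eg Egg] := hmom i i.
have gi := hdiag i; set X := (fun w => _) in gi.
have gX w : G w i i = (X w)%:C%C.
  by rewrite /X; case: (G w i i) (Im_diag i w) => a b /= ->.
have EX : \int[P]_w X w = 0.
  by move: Eg; rewrite cexpectationE => -[].
have fE a : (fun w => gE (i, i) w ^+ a * (gE (i, i) w)^* ^+ 0) =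
    (fun w => (X w ^+ a)%:C%C).
  by apply/funext => w; rewrite expr0 mulr1 /gE/= gX rmorphXn.
have muE a : mu (i, i) a 0 = (\int[P]_w X w ^+ a)%:C%C.
  by rewrite /mu fE cexpectationE/= Rintegral_cst// mul0r.
split=> [a|a].
  rewrite fE; split; last exact: finite_measure_integrable_cst.
  exact: integrable_gaussian_exprn.
have [u mom] := real_gaussian_moments gi EX.
have uv : u = v.
  have [_] := mom 0%N.
  rewrite mul1r; under [X in _ = _ * X]eq_Rintegral do rewrite expr0.
  rewrite Rintegral_cst// [fine _](congr1 fine (probability_setT P)) !mulr1 => <-.
  have nX : (fun w => `|G w i i| ^+ 2) = (fun w => (X w ^+ 2)%:C%C).
    apply/funext => w; have [+ _ _ _ _] := gG => /(_ w i i) herm.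
    by rewrite normCK -herm gX -expr2 rmorphXn.
  by move: Egg; rewrite -vC nX cexpectationE/= => -[].
case: a => [|a].
  by rewrite muE !mul0r; under eq_Rintegral do rewrite expr1; rewrite EX.
by rewrite !muE (mom a).2 uv !rmorphM/= vC rmorph_nat.
Qed.

Let ea k l := count_mem k l.
(** Excluding [x = k] prevents a diagonal entry, where [flip k = k], from being counted twice. *)
Let eb k l := count (fun x => (x != k) && (x == flip k)) l.

Let rep x := if x \in D then x else flip x.


Let expm k l w := gE k w ^+ ea k l * (gE k w)^* ^+ eb k l.

Let repD x : rep x \in D.
Proof.
rewrite /rep; case: ifP => // /negbT; rewrite !inE -ltnNge /flip/=.
exact: ltnW.
Qed.

(* The factors of the class of [x] are the only ones that [x] contributes to. *)
Let not_rep k x : k \in D -> k != rep x -> x != k /\ x != flip k.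
Proof.
move=> kD; have := repD x; rewrite /rep; case: ifP => xD _ kx; split.
- by rewrite eq_sym.
- apply: contraNneq kx => xk; move: xD kD; rewrite {}xk !inE.
  case: k => i j /= ji ij.
  by rewrite /flip xpair_eqE -!val_eqE/= !eqn_leq ji ij.
- by apply: contraFneq xD => ->.
- by apply: contraNneq kx => ->; rewrite flipK.
Qed.

Let expm_cons x l w :
  \prod_(k in D) expm k (x :: l) w = gE x w * \prod_(k in D) expm k l w.
Proof.
rewrite (bigD1 (rep x)) ?repD//= [in RHS](bigD1 (rep x)) ?repD//= mulrA.
congr (_ * _); last first.
  apply: eq_bigr => k /andP[kD kx]; have [h1 h2] := not_rep kD kx.
  by rewrite /expm /ea /eb /= (negbTE h1) (negbTE h2) andbF.
rewrite /expm /ea /eb /= /rep; case: ifP => xD; first by rewrite eqxx/= add0n exprS mulrA.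
have fD : flip x \in D by have := repD x; rewrite /rep xD.
have xf : x != flip x by apply: contraFneq xD => e; rewrite e.
by rewrite (negbTE xf)/= flipK eqxx add0n exprS gE_flip conjCK mulrCA.
Qed.

Let prodE l w : \prod_(x <- l) gE x w = \prod_(k in D) expm k l w.
Proof.
elim: l => [|x l IH]; last by rewrite big_cons IH expm_cons.
by rewrite big_nil big1// => k _; rewrite /expm/= !expr0 mulr1.
Qed.


Let eb_diag k l : k.1 = k.2 -> eb k l = 0%N.
Proof.
case: k => i j /= ->; rewrite /eb (eq_count (a2 := pred0)) ?count_pred0// => x /=.
by rewrite /flip/=; case: (x == _).
Qed.

Let expm_int k l : cintegrable P (fun w => gE k w ^+ ea k l * (gE k w)^* ^+ eb k l).
Proof.
have [kk|kk] := eqVneq k.1 k.2; last exact: (offdiag_moment kk _ _).1.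
by rewrite eb_diag//; exact: (diag_moment kk).1.
Qed.

Let moment_prod l : cintegrable P (fun w => \prod_(x <- l) gE x w) /\
  cexpectation P (fun w => \prod_(x <- l) gE x w) = \prod_(k in D) mu k (ea k l) (eb k l).
Proof.
pose X k := Re_Im (gE k).
have mX k : measurable_fun setT (X k).
  by have [mr mi] := gE_measurable k; exact: measurable_fun_pair.
have indX (B : E -> set (R * R)) : (forall k, measurable (B k)) ->
    P (\bigcap_(k in [set` D]) (X k @^-1` B k)) =
    (\prod_(k in D) P (X k @^-1` B k))%E.
  by move=> mB; have [_ + _ _ _] := gG => /(_ D B (subxx _) mB).
pose z (y : R * R) : R[i] := Complex y.1 y.2.
have mz : cmeasurable z by split; [exact: measurable_fst|exact: measurable_snd].
pose f k y := z y ^+ ea k l * (z y)^* ^+ eb k l.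
have mf k : cmeasurable (f k).
  by apply: cmeasurableM; apply: cmeasurableX => //; exact: cmeasurableC.
have zX k w : z (X k w) = gE k w by rewrite /z /X /Re_Im /=; case: (gE k w).
have fX k : f k \o X k = (fun w => expm k l w).
  by apply/funext => w; rewrite /f /= zX.
have := cexpectation_prod_indep mX indX (fun k => (mf k).1) (fun k => (mf k).2).
have -> : (fun w => \prod_(k in D) f k (X k w)) = (fun w => \prod_(x <- l) gE x w).
  apply/funext => w; rewrite prodE; apply: eq_bigr => k _.
  exact: (congr1 (fun h => h w) (fX k)).
case=> [k|intp ->]; first by rewrite fX; exact: expm_int.
by split => //; apply: eq_bigr => k _; rewrite fX.
Qed.

Let picks_count (a : pred E) l p : p \in picks l -> count a l = (a p.1 + count a p.2)%N.
Proof. by move=> /perm_picks/seq.permP/(_ a) <-. Qed.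

Let eb_offdiag k l : flip k != k -> eb k l = count_mem (flip k) l.
Proof.
move=> kk; apply: eq_count => x /=; case: (x =P flip k) => [->|]; last by rewrite andbF.
by rewrite kk.
Qed.

Let flip_neq k : (flip k == k) = (k.1 == k.2).
Proof. by case: k => i j; rewrite /flip xpair_eqE/= eq_sym andbb. Qed.

(** Gaussian integration by parts, read off from the explicit moments. *)
Let offdiag_moment_rec k a c : k.1 != k.2 ->
  mu k a.+1 c = c%:R * n%:R^-1 * mu k a c.-1 /\
  mu k c a.+1 = c%:R * n%:R^-1 * mu k c.-1 a.
Proof.
move=> kk; rewrite !(offdiag_moment kk _ _).2 (eq_sym c) (eq_sym c.-1).
case: c => [|c]; first by rewrite !mul0r.
rewrite eqSS /=; case: eqP => [->|_]; last by rewrite mulr0.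
by rewrite factS natrM exprS invfM mulrACA.
Qed.

(** Integration by parts removes [x] and one occurrence of [flip x]. The exponents left do not
    depend on the occurrence, so all of them contribute equally. *)
Let rep_moment x l : exists a b,
  mu (rep x) (ea (rep x) (x :: l)) (eb (rep x) (x :: l)) =
    (count_mem (flip x) l)%:R * n%:R^-1 * mu (rep x) a b /\
  forall p, p \in picks l -> p.1 = flip x -> ea (rep x) p.2 = a /\ eb (rep x) p.2 = b.
Proof.
set c := count_mem _ l.
have pc p : p \in picks l -> p.1 = flip x -> count_mem (flip x) p.2 = c.-1.
  by move=> /(picks_count (pred1 (flip x))) + px; rewrite /c => -> /=; rewrite px eqxx.
have [xx|xx] := eqVneq x.1 x.2.
  have fx : flip x = x by apply/eqP; rewrite flip_neq xx.
  have -> : rep x = x by rewrite /rep fx if_same.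
  exists c.-1, 0%N; rewrite !eb_diag//; split=> [|p pl px].
    by rewrite /ea /= eqxx add1n -[X in count_mem X]fx (diag_moment xx).2.
  by rewrite eb_diag// /ea -[X in count_mem X]fx pc.
have fx : flip x != x by rewrite flip_neq.
have xf : x != flip x by rewrite eq_sym.
have px_count p : p \in picks l -> p.1 = flip x -> count_mem x p.2 = count_mem x l.
  by move=> /(picks_count (pred1 x)) + px => -> /=; rewrite px (negbTE fx).
rewrite /rep; case: ifP => xD.
  exists (count_mem x l), c.-1; split=> [|p pl px].
    rewrite eb_offdiag// /ea /= eqxx (negbTE xf) add1n add0n.
    by rewrite (offdiag_moment_rec _ _ xx).1.
  by rewrite eb_offdiag// /ea px_count// pc.
have ffx : flip (flip x) != flip x by rewrite flipK.
exists c.-1, (count_mem x l); split=> [|p pl px].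
  rewrite eb_offdiag// /ea /= flipK eqxx (negbTE xf) add1n add0n.
  by rewrite (offdiag_moment_rec _ _ _).2// -flip_neq.
by rewrite eb_offdiag// flipK /ea px_count// pc.
Qed.

Lemma gaussian_matrix_wick l :
  cintegrable P (fun w => \prod_(x <- l) G w x.1 x.2) /\
  cexpectation P (fun w => \prod_(x <- l) G w x.1 x.2) = wick (@entry_cov R[i] n) [::] l.
Proof.
split; first exact: (moment_prod l).1.
apply: (wickE (f := fun l => cexpectation P (fun w => \prod_(x <- l) gE x w))).
  under eq_fun do rewrite big_nil.
  exact: cexpectation_cst.
move=> {}x {}l; rewrite (moment_prod _).2.
have [a [b [muE abP]]] := rep_moment x l.
pose Q := \prod_(k in D | k != rep x) mu k (ea k l) (eb k l).
rewrite (bigD1 (rep x)) ?repD//= muE.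
(* The number of occurrences of [flip x] becomes a sum over the choice of one; the factor [Q] of the
   other classes is the same for all of them. *)
transitivity (\sum_(p <- picks l)
    if p.1 == flip x then n%:R^-1 * (mu (rep x) a b * Q) else 0).
  rewrite -big_mkcond/= -(big_map fst (fun y => y == flip x) (fun=> _)) map_fst_picks.
  rewrite big_const_seq iter_addr addr0 -[RHS]mulr_natl !mulrA; congr (_ * _).
  apply: eq_bigr => k /andP[kD kx]; have [h1 h2] := not_rep kD kx.
  by rewrite /ea /eb /= (negbTE h1) (negbTE h2) andbF.
rewrite big_seq [RHS]big_seq; apply: eq_bigr => p pl.
rewrite /entry_cov [x == _]eq_sym (can2_eq (@flipK _) (@flipK _)).
case: eqP => [px|]; last by rewrite mul0r.
congr (_ * _); rewrite (moment_prod _).2 [RHS](bigD1 (rep x)) ?repD//=.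
have [-> ->] := abP p pl px; congr (_ * _).
apply: eq_bigr => k /andP[kD kx]; have [h1 h2] := not_rep kD kx.
have f1 : flip x != k.
  by apply: contraNneq h2 => <-; rewrite flipK.
have f2 : flip x != flip k by rewrite (inj_eq (can_inj (@flipK _))).
by rewrite /ea /eb !(picks_count _ pl) /= px (negbTE f1) (negbTE f2) andbF.
Qed.

End GaussianMatrixWick.

(** * Moments of words of matrices *)

Lemma tnth_entry_perm (R : realType) (d : nat -> measure_display)
    (T : forall N : nat, measurableType (d N))
    (G : forall N : nat, T N -> 'M[R[i]]_(N * N)%N) (k : 'I_3) N (w : T N) :
  tnth [tuple G; fun N w => mx_perm (G N w) (partial_transpose N);
                 fun N w => mx_perm (G N w) (mixing_map N)] k N w =
  mx_perm (G N w) (entry_perm N k).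
Proof.
case: k => -[|[|[]]]// lt_k; rewrite /entry_perm !(tnth_nth 1%g) !(tnth_nth G)//=.
by apply/matrixP => i j; rewrite !mxE perm1.
Qed.

Lemma prod_mx_perm_paths (F : numFieldType) N (B : 'M[F]_(N * N)) (l : seq 'I_3) i j :
  (\prod_(k <- l) mx_perm B (entry_perm N k)) i j =
  \sum_(e <- paths l i j) \prod_(x <- e) B x.1 x.2.
Proof.
elim: l i => [|k l IH] i.
  by rewrite big_nil mxE /=; case: eqP => _; rewrite ?big_seq1 ?big_nil.
rewrite big_cons -[_ * _]/(_ *m _) mxE /= big_allpairs_dep big_enum/=.
apply: eq_bigr => i' _; rewrite IH mxE mulr_sumr.
by apply: eq_bigr => e _; rewrite big_cons.
Qed.

Section TraceMoment.
Context d (T : measurableType d) (R : realType) (P : probability T R).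
Variables (N : nat) (G : T -> 'M[R[i]]_(N * N)).
Hypothesis gG : (0 < N)%N -> gaussian_matrix P G.

Lemma trace_moment (l : seq 'I_3) :
  let m w := normalized_trace (\prod_(k <- l) mx_perm (G w) (entry_perm N k)) in
  cintegrable P m /\
  ((0 < N)%N -> cexpectation P m = open_sum R[i] N [::] l / (N * N)%:R).
Proof.
move=> m.
have mE : m = fun w => (N * N)%:R^-1 * \sum_(i <- enum 'I_(N * N))
    \sum_(e <- paths l i i) \prod_(x <- e) G w x.1 x.2.
  apply/funext => w; rewrite /m /normalized_trace /mxtrace big_enum/=.
  by congr (_ * _); apply: eq_bigr => i _; exact: prod_mx_perm_paths.
(* Integrability is claimed for N = 0 too, where the matrix is not assumed Gaussian; as the inverse
   of 0 is 0, the normalized trace is then constant. *)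
case: (posnP N) => [N0|N0].
  split=> [|//].
  rewrite (_ : m = cst 0); first exact: cintegrable_cst.
  have NN0 : (N * N)%:R = 0 :> R[i] by rewrite N0.
  by apply/funext => w; rewrite mE NN0 invr0 mul0r.
have mom := gaussian_matrix_wick (gG N0).
have int1 i : cintegrable P (fun w => \sum_(e <- paths l i i) \prod_(x <- e) G w x.1 x.2).
  by apply: cintegrable_sum => e; exact: (mom e).1.
have int2 : cintegrable P (fun w => \sum_(i <- enum 'I_(N * N))
    \sum_(e <- paths l i i) \prod_(x <- e) G w x.1 x.2) by exact: cintegrable_sum.
rewrite mE; split=> [|_]; first exact: cintegrableZ.
rewrite cexpectationZ// cexpectation_sum// mulrC; congr (_ * _).
rewrite /open_sum /= big_map; apply: eq_bigr => i _.
rewrite cexpectation_sum; last by move=> e; exact: (mom e).1.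
by apply: eq_bigr => e _; exact: (mom e).2.
Qed.

End TraceMoment.

(* Stated for an abstract field, where the topology of the norm is inferred. *)
Lemma cvg_closed_field (C : numClosedFieldType) (f : nat -> C) (l : C) :
  (forall eps, 0 < eps -> \forall N \near \oo, `|l - f N| <= eps) ->
  f @ \oo --> l.
Proof. by move=> fl; exact/cvgrPdist_le. Qed.

Theorem corollary3p7 (R : realType) (d : nat -> measure_display)
    (T : forall N : nat, measurableType (d N))
    (P : forall N : nat, probability (T N) R)
    (G : forall N : nat, T N -> 'M[R[i]]_(N * N)%N)
    (hG : forall N : nat, (0 < N)%N -> gaussian_matrix (P N) (G N)) :
  asymptotically_free P
    (tnth [tuple G;
                 fun N w => mx_perm (G N w) (partial_transpose N);
                 fun N w => mx_perm (G N w) (mixing_map N)]).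
Proof.
exists (fock_space R[i]), (@limit_op R[i]); split; first exact: limit_op_free.
move=> r k r0 m; pose l := [seq k s | s <- index_enum 'I_r].
have mE N : m N = fun w => normalized_trace
    (\prod_(j <- l) mx_perm (G N w) (entry_perm N j)).
  apply/funext => w; rewrite /m /l big_map.
  by congr normalized_trace; apply: eq_bigr => s _; exact: tnth_entry_perm.
have mom N := trace_moment (hG N) l.
split=> [N|]; first by rewrite mE; exact: (mom N).1.
have -> : \prod_(s < r) limit_op R[i] (k s) = \prod_(j <- l) limit_op R[i] j.
  by rewrite /l big_map.
rewrite limit_op_moment.
have [K KP] := fock_count_limit R[i] [::] l.
(* In the order of the complex numbers a positive tolerance is real, so it reduces to its real part
   [x]. *)
apply: cvg_closed_field => -[x y]; rewrite ltcE/= => /andP[/eqP -> x0]; near=> N.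
have N0 : (0 < N)%N by near: N; exact: nbhs_infty_gt.
have NR : 0 < N%:R :> R[i] by rewrite ltr0n.
rewrite mE (mom N).2//.
have -> : (fock_count [::] l)%:R - open_sum R[i] N [::] l / (N * N)%:R =
    - ((open_sum R[i] N [::] l - (fock_count [::] l)%:R * (N * N)%:R) / (N * N)%:R).
  rewrite natrM; field; exact: lt0r_neq0.
rewrite normrN normrM normfV normr_nat ler_pdivrMr; last by rewrite ltr0n muln_gt0 N0.
(* The error K N / N^2 is K / N, hence at most [x] once N >= K / x. *)
apply: (le_trans (KP N N0)); rewrite natrM mulrA ler_pM2r//.
rewrite -(rmorph_nat (real_complex R) K) -(rmorph_nat (real_complex R) N).
rewrite -[Complex x 0]/(x%:C%C) -rmorphM/= lecR -ler_pdivrMl// mulrC.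
by near: N; exact: nbhs_infty_ger.
Unshelve. all: by end_near. Qed.
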